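(* Let $r_2(\boldsymbol{k})=\max\left(\operatorname{width}(\operatorname{supp}(\boldsymbol{k})),\ \log\min_{j\in\operatorname{supp}(\boldsymbol{k})}|k_j|\right)$ for $\boldsymbol{k}\in\mathbb{Z}^d\setminus\{\boldsymbol{0}\}$ and $r_2(\boldsymbol{0})=1$. There exists a constant $C>0$ such that for every $d\in\mathbb{N}$ and every $\varepsilon\in(0,1)$, \[n^{\mathrm{wor}}(\varepsilon,d,F_{d,r_2})\leq C\,\varepsilon^{-3}/\log(\varepsilon^{-1}).\]
   Context: For a weight function $r:\mathbb{Z}^d\to[1,\infty)$, let \[F_{d,r}=\Big\{f\in C([0,1)^d)\ \text{real-valued}:\ \|f\|:=\sum_{\boldsymbol{k}\in\mathbb{Z}^d}|\hat f(\boldsymbol{k})|\,r(\boldsymbol{k})<\infty\Big\},\qquad \hat f(\boldsymbol{k})=\int_{[0,1)^d}f(\boldsymbol{x})e^{-2\pi\mathrm{i}\boldsymbol{k}\cdot\boldsymbol{x}}\,\mathrm{d}\boldsymbol{x}.\] Let $I_d(f)=\int_{[0,1)^d}f$. A linear algorithm using $n$ points is $Q_{d,n}(f)=\sum_{h=0}^{n-1}c_hf(\boldsymbol{x}_h)$ with $\boldsymbol{x}_h\in[0,1)^d$, $c_h\in\mathbb{R}$; its worst-case error is $e^{\mathrm{wor}}(F_{d,r},Q_{d,n})=\sup_{\|f\|\leq1}|I_d(f)-Q_{d,n}(f)|$, and $n^{\mathrm{wor}}(\varepsilon,d,F_{d,r})=\min\{n:\exists Q_{d,n},\ e^{\mathrm{wor}}(F_{d,r},Q_{d,n})\leq\varepsilon\}$.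 For $\boldsymbol{k}\in\mathbb{Z}^d$, $\operatorname{supp}(\boldsymbol{k})=\{j\in\{1,\dots,d\}:k_j\neq0\}$, and for nonempty $S\subseteq\{1,\dots,d\}$, $\operatorname{width}(S)=\max S-\min S+1$. $\log$ is the natural logarithm. *)

(* Defs.v *)
From HB Require Import structures.
From mathcomp Require Import all_boot all_order all_algebra.
From mathcomp Require Import complex.
From mathcomp Require Import all_classical all_reals all_analysis.

Set Implicit Arguments.
Unset Strict Implicit.
Unset Printing Implicit Defensive.

Import Order.TTheory GRing.Theory Num.Theory.
Import numFieldNormedType.Exports.

Local Open Scope classical_set_scope.
Local Open Scope complex_scope.
Local Open Scope ring_scope.

Section lebesgue_tuple.
Context {R : realType}.
Local Notation tupleR n := (n.-tuple (measurableTypeR R)).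

Definition tcons n (p : measurableTypeR R * tupleR n) : tupleR n.+1 :=
  [tuple of p.1 :: p.2].

(* n-dimensional Lebesgue measure as an iterated product measure; n-tuples
   carry the product sigma-algebra. In dimension 0 it is the unit point mass. *)
Fixpoint lebesgue_tuple n : set (tupleR n) -> \bar R :=
  match n with
  | 0 => dirac [tuple]
  | n'.+1 => pushforward (@lebesgue_measure R \x @lebesgue_tuple n')%E
                         (@tcons n')
  end.

Lemma measurable_tcons n : measurable_fun setT (@tcons n).
Proof. exact: measurable_cons. Qed.

(* The successor step for an arbitrary m, on which structures can be declared;
   lebesgue_tuple inherits them by induction. *)
Section lebesgue_tuple_succ.
Variables (n : nat) (m : {sigma_finite_measure set (tupleR n) -> \bar R}).

Definition lebesgue_tuple_succ : set (tupleR n.+1) -> \bar R :=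
  pushforward (@lebesgue_measure R \x m)%E (@tcons n).

HB.instance Definition _ := Measure.copy lebesgue_tuple_succ
  (measure_function_pushforward__canonical__measure_function_Measure
    (@lebesgue_measure R \x m)%E (@measurable_tcons n)).

Let lebesgue_tuple_succ_sigma_finite : sigma_finite setT lebesgue_tuple_succ.
Proof.
have /sigma_finiteP[F [FT ndF Foo]] := sigma_finiteT (@lebesgue_measure R).
have /sigma_finiteP[G [GT ndG Goo]] := sigma_finiteT m.
pose H i := [set t : tupleR n.+1 |
  F i (tnth t ord0) /\ G i [tuple of behead t]].
have HE i : @tcons n @^-1` H i = F i `*` G i.
  apply/seteqP; split=> -[a b] /=; rewrite /H /= /tcons /=;
    by rewrite (_ : [tuple of _] = b) //; exact: val_inj.
exists H.
  apply/esym/seteqP; split=> // t _.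
  have: (\bigcup_i F i) (tnth t ord0) by rewrite -FT.
  have: (\bigcup_i G i) [tuple of behead t] by rewrite -GT.
  move=> [i _ Gi] [j _ Fj]; exists (maxn i j) => //; split.
  - by move: Fj; exact/subsetPset/ndF/leq_maxr.
  - by move: Gi; exact/subsetPset/ndG/leq_maxl.
move=> i; have [mF lF] := Foo i; have [mG lG] := Goo i; split.
  apply: measurableI.
  - by rewrite -[X in measurable X]setTI; exact: measurable_tnth.
  - by rewrite -[X in measurable X]setTI; exact: measurable_behead.
rewrite /lebesgue_tuple_succ /pushforward HE product_measure1E//.
by rewrite lte_mul_pinfty// ge0_fin_numE.
Qed.

HB.instance Definition _ := Measure_isSigmaFinite.Build _ _ _
  lebesgue_tuple_succ lebesgue_tuple_succ_sigma_finite.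

End lebesgue_tuple_succ.

Lemma lebesgue_tuple_sfm n :
  {m : {sigma_finite_measure set (tupleR n) -> \bar R} |
    @lebesgue_tuple n = m}.
Proof.
elim: n => [|n [m mE]] /=; first by exists (dirac [tuple]).
by exists (lebesgue_tuple_succ m); rewrite mE.
Qed.

Let lebesgue_tuple0 n : @lebesgue_tuple n set0 = 0%E.
Proof. by case: (lebesgue_tuple_sfm n) => m ->; exact: measure0. Qed.

Let lebesgue_tuple_ge0 n A : (0 <= @lebesgue_tuple n A)%E.
Proof. by case: (lebesgue_tuple_sfm n) => m ->; exact: measure_ge0. Qed.

Let lebesgue_tuple_sigma_additive n : semi_sigma_additive (@lebesgue_tuple n).
Proof.
by case: (lebesgue_tuple_sfm n) => m ->; exact: measure_semi_sigma_additive.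
Qed.

HB.instance Definition _ n := isMeasure.Build _ _ _ (@lebesgue_tuple n)
  (@lebesgue_tuple0 n) (@lebesgue_tuple_ge0 n)
  (@lebesgue_tuple_sigma_additive n).

Let lebesgue_tuple_sigma_finite n : sigma_finite setT (@lebesgue_tuple n).
Proof. by case: (lebesgue_tuple_sfm n) => m ->; exact: sigma_finiteT. Qed.

HB.instance Definition _ n := Measure_isSigmaFinite.Build _ _ _
  (@lebesgue_tuple n) (@lebesgue_tuple_sigma_finite n).

End lebesgue_tuple.
Arguments lebesgue_tuple {R} n _.

Section integration.
Context {R : realType}.
Implicit Types (d n : nat).

Definition unit_cube d : set 'rV[R]_d := [set x | forall i, 0 <= x 0 i < 1].

(* Row vectors carry the topology, tuples the sigma-algebra and the measure;
   this bijection transfers integrands from the former to the latter. *)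
Definition row_of_tuple d (t : d.-tuple (measurableTypeR R)) : 'rV[R]_d :=
  \row_i tnth t i.

Definition cube_integrable d (f : 'rV[R]_d -> R) : Prop :=
  (lebesgue_tuple d).-integrable (@row_of_tuple d @^-1` @unit_cube d)
    (EFin \o f \o @row_of_tuple d).

Definition cube_integral d (f : 'rV[R]_d -> R) : R :=
  \int[lebesgue_tuple d]_(t in @row_of_tuple d @^-1` @unit_cube d)
    f (row_of_tuple t).

Definition cube_integralC d (f : 'rV[R]_d -> R[i]) : R[i] :=
  cube_integral (fun x => complex.Re (f x)) +i*
  cube_integral (fun x => complex.Im (f x)).

Definition expi (t : R) : R[i] := cos t +i* sin t.

Definition dotp d (k : 'rV[int]_d) (x : 'rV[R]_d) : R :=
  \sum_i (k 0 i)%:~R * x 0 i.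

Definition fourier_coef d (f : 'rV[R]_d -> R) (k : 'rV[int]_d) : R[i] :=
  cube_integralC (fun x => (f x)%:C * expi (- (2 * pi * dotp k x))).

Definition weighted_norm d (r : 'rV[int]_d -> R) (f : 'rV[R]_d -> R) : \bar R :=
  \esum_(k in [set: 'rV[int]_d]) (Normc.normc (fourier_coef f k) * r k)%:E.

(* F_{d,r}. Only the values of f on the half-open cube matter. A function that
   is continuous on the half-open cube may fail to be integrable there, in which
   case its Fourier coefficients are undefined: integrability is therefore part
   of the finiteness of the norm. *)
Definition wiener_space d (r : 'rV[int]_d -> R) : set ('rV[R]_d -> R) :=
  [set f | [/\ {within @unit_cube d, continuous f}, cube_integrable f &
               (weighted_norm r f < +oo)%E]].

Definition linear_algorithm d n (c : 'I_n -> R) (x : 'I_n -> 'rV[R]_d)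
    (f : 'rV[R]_d -> R) : R :=
  \sum_(h < n) c h * f (x h).

Definition worst_case_error d (r : 'rV[int]_d -> R)
    (Q : ('rV[R]_d -> R) -> R) : \bar R :=
  ereal_sup [set `|cube_integral f - Q f|%:E |
             f in [set f | wiener_space r f /\ (weighted_norm r f <= 1)%E]].

(* The least admissible number of points, as an extended real: the infimum of a
   nonempty set of naturals is its minimum, and that of the empty set is +oo. *)
Definition n_wor (eps : R) d (r : 'rV[int]_d -> R) : \bar R :=
  ereal_inf [set n%:R%:E | n in [set n : nat |
    exists (c : 'I_n -> R) (x : 'I_n -> 'rV[R]_d),
      (forall h, unit_cube (x h)) /\
      (worst_case_error r (linear_algorithm c x) <= eps%:E)%E]].

End integration.

Section weights.
Implicit Types d : nat.

Definition supp d (k : 'rV[int]_d) : {set 'I_d} := [set j | k 0%R j != 0%R]%SET.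

(* The seed of the iterated minimum is at least every F j, so that for nonempty
   S the result is the minimum of F over S; it is 0 for empty S. *)
Definition minimum_over d (S : {set 'I_d}) (F : 'I_d -> nat) : nat :=
  \big[minn/(\max_(j in S) F j)%N]_(j in S) F j.

(* Coordinates are numbered from 0, which does not affect the width. *)
Definition width d (S : {set 'I_d}) : nat :=
  ((\max_(j in S) nat_of_ord j) - minimum_over S (@nat_of_ord d) + 1)%N.

Definition r2 {R : realType} d (k : 'rV[int]_d) : R :=
  if k == 0 then 1
  else Num.max (width (supp k))%:R
               (ln (minimum_over (supp k) (fun j => `|k 0%R j|%N))%:R).

Lemma r2_ge1 {R : realType} d (k : 'rV[int]_d) : 1 <= r2 k :> R.
Proof.
rewrite /r2; case: ifP => // _; rewrite le_max; apply/orP; left.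
by rewrite ler1n /width addn1.
Qed.

End weights.

(* Main.v *)
(* For a prime p, the p^2 nodes x_j = {h l^j / p}, h, l < p, integrate the
   character of frequency k up to the proportion of those l with
   \sum_j k_j l^j = 0 mod p. This proportion is at most width(supp k) / p,
   unless p divides every k_j, when it is bounded by 1; that happens for at most
   log(min |k_j|) / log(M / 4) primes in (M / 4, M]. So the average of these
   rules over a family of about M / log M such primes (a window that is rich
   enough by Chebyshev's argument, when M is a power of 4) has error O(r2(k) / M)
   at every k, at the cost of O(M^3 / log M) nodes. The error for f is then at
   most \sum_k |fhat(k)| O(r2(k) / M) as soon as f can be replaced by
   trigonometric polynomials at the nodes. Convolution with a tensor power of
   ((1 + cos(2 pi y)) / 2)^N, normalised, does this: it damps the Fourier
   coefficients, and recovers f at every interior point of the cube where f is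
   continuous, even though f may be unbounded near the boundary. The nodes are
   therefore shifted by 1 / (2 p) into the open cube. *)
Require Import Defs.
From HB Require Import structures.
From mathcomp Require Import all_boot all_order all_algebra.
From mathcomp Require Import complex zify ring lra.
From mathcomp Require Import all_classical all_reals all_analysis.
From mathcomp Require Import measurable_realfun.

Set Implicit Arguments.
Unset Strict Implicit.
Unset Printing Implicit Defensive.

Import Order.TTheory GRing.Theory Num.Theory.
Import numFieldNormedType.Exports.

(** * Primes between a power of 4 and the next *)

(** Consecutive binomials in row [2 n] have ratio [(2 n - m) / (m + 1)], so they increase up to the
    middle; symmetry gives the other half. This serves both the prime count and the damping of
    Fourier coefficients. *)
Lemma leq_bin_central n m : 'C(n.*2, m) <= 'C(n.*2, n).
Proof.
have inc k : k <= n -> 'C(n.*2, n - k) <= 'C(n.*2, n).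
  elim: k => [|k IH] kn; first by rewrite subn0.
  apply: leq_trans (IH (ltnW kn)).
  have := mul_bin_left n.*2 (n - k.+1).
  rewrite (_ : (n - k.+1).+1 = n - k); last by lia.
  move=> E; rewrite -(@leq_pmul2l (n - k)); last by lia.
  by rewrite E leq_mul2r; apply/orP; right; lia.
have [mn|nm] := leqP m n.
  by rewrite -(subKn mn); apply: inc; lia.
have [m2|m2] := leqP m n.*2; last by rewrite bin_small.
by rewrite -bin_sub// (_ : n.*2 - m = n - (m - n)) ?inc//; lia.
Qed.

(** The middle term is the largest of the [2 n + 1] terms of [(1 + 1) ^ (2 n)]. *)
Lemma expn4_leq_central n : 4 ^ n <= n.*2.+1 * 'C(n.*2, n).
Proof.
rewrite (_ : 4 ^ n = (1 + 1) ^ n.*2); last by rewrite -mul2n expnM.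
rewrite expnDn; apply: (@leq_trans (\sum_(i < n.*2.+1) 'C(n.*2, n))).
  by apply: leq_sum => i _; rewrite !exp1n !muln1 leq_bin_central.
by rewrite sum_nat_const card_ord.
Qed.

Lemma central_leq_expn4 n : 'C(n.*2, n) <= 4 ^ n.
Proof.
rewrite (_ : 4 ^ n = (1 + 1) ^ n.*2); last by rewrite -mul2n expnM.
have H : n < n.*2.+1 by lia.
rewrite expnDn (bigD1 (Ordinal H))//= !exp1n !muln1; exact: leq_addr.
Qed.

Lemma prod_primes_dvd (s : seq nat) m :
  uniq s -> all prime s -> all (dvdn^~ m) s -> \prod_(p <- s) p %| m.
Proof.
elim: s => [|p s IH] /=; first by rewrite big_nil dvd1n.
move=> /andP[pns us] /andP[pp sp] /andP[pm sm]; rewrite big_cons Gauss_dvd ?pm ?IH//.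
rewrite big_seq; elim/big_rec: _ => [|q x qs cpx]; first exact: coprimen1.
rewrite coprimeMr cpx andbT prime_coprime// dvdn_prime2//; last exact: (allP sp).
by apply: contraNN pns => /eqP ->.
Qed.

Lemma leq_pow_prod (s : seq nat) m :
  (forall p, p \in s -> m <= p) -> m ^ size s <= \prod_(p <- s) p.
Proof.
elim: s => [|p s IH] h; first by rewrite big_nil.
rewrite big_cons /= expnS leq_mul ?h ?mem_head// IH// => q qs.
by rewrite h// inE qs orbT.
Qed.

(** Such a [p] divides [(2 n)!] but, exceeding [n], not [n!]. *)
Lemma prime_dvd_central n p : prime p -> n < p <= n.*2 -> p %| 'C(n.*2, n).
Proof.
move=> pp /andP[np pn].
have h := @bin_fact n.*2 n; rewrite -addnn leq_addr addnK in h.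
have : p %| (n + n)`! by apply: dvdn_fact; rewrite addnn pn prime_gt0.
rewrite -(h isT) Euclid_dvdM// Euclid_dvdM// orbb orbC addnn.
case/orP => //; have : forall k, k < p -> ~~ (p %| k`!).
  elim=> [|k IH] kp; first by rewrite Euclid_dvd1.
  rewrite factS Euclid_dvdM// negb_or IH 1?ltnW// andbT.
  by rewrite gtnNdvd.
by move=> /(_ n np) /negbTE ->.
Qed.

(** At powers of 2 the induction is a doubling: the primes in [(2 ^ j, 2 ^ j.+1]] all divide a
    central binomial coefficient that is at most [4 ^ (2 ^ j)]. *)
Lemma primorial_leq j : \prod_(0 <= p < (2 ^ j).+1 | prime p) p <= 4 ^ (2 ^ j).
Proof.
elim: j => [|j IH]; first by rewrite big_mkcond unlock.
rewrite (@big_cat_nat _ _ _ (2 ^ j).+1) //=; last by rewrite ltnS leq_exp2l.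
have E : 2 ^ j.+1 = (2 ^ j).*2 by rewrite expnS mul2n.
apply: (@leq_trans (4 ^ (2 ^ j) * 4 ^ (2 ^ j))); last by rewrite -expnD addnn E.
apply: leq_mul => //; apply: leq_trans (central_leq_expn4 _).
apply: dvdn_leq; first by rewrite bin_gt0; lia.
rewrite -big_filter; apply: prod_primes_dvd.
- by rewrite filter_uniq// iota_uniq.
- by apply/allP => p; rewrite mem_filter => /andP[].
- apply/allP => p; rewrite mem_filter mem_index_iota => /and3P[pp h1 h2].
  by apply: prime_dvd_central => //; lia.
Qed.

(* Legendre: each prime power up to [2 n] contributes at most 1 to the valuation. *)
Lemma logn_central n p : prime p -> p ^ logn p 'C(n.*2, n) <= maxn n.*2 1.
Proof.
move=> pp.
case: (posnP n) => [->|n0]; first by rewrite bin0 logn1.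
have L : logn p 'C(n.*2, n) <= trunc_log p n.*2.
  have h := @bin_fact n.*2 n; rewrite -addnn leq_addr addnK in h.
  have := congr1 (logn p) (h isT).
  rewrite !lognM ?muln_gt0 ?fact_gt0 ?bin_gt0 ?leq_addr// !logn_fact// => E.
  rewrite addnn in E.
  have E2 : \sum_(1 <= k < n.*2.+1) n %/ p ^ k = \sum_(1 <= k < n.+1) n %/ p ^ k.
    rewrite (@big_cat_nat _ _ _ n.+1)//=; last by lia.
    rewrite [X in _ + X]big1_seq ?addn0// => k /=; rewrite mem_index_iota => /andP[nk _].
    by rewrite divn_small// (leq_trans nk)// ltnW// ltn_expl// prime_gt1.
  rewrite -E2 in E.
  suff : \sum_(1 <= k < n.*2.+1) n.*2 %/ p ^ k <=
     trunc_log p n.*2 +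
     (\sum_(1 <= k < n.*2.+1) n %/ p ^ k + \sum_(1 <= k < n.*2.+1) n %/ p ^ k).
    by rewrite -E leq_add2r.
  apply: (@leq_trans (\sum_(1 <= k < n.*2.+1)
      ((k <= trunc_log p n.*2) + (n %/ p ^ k + n %/ p ^ k)))).
    rewrite big_nat [leqRHS]big_nat; apply: leq_sum => k /andP[k0 kn].
    have [kt|kt] := leqP k.
      have p0 : 0 < p ^ k by rewrite expn_gt0 prime_gt0.
      rewrite -ltnS ltn_divLR// (_ : (1 + _).+1 = (n %/ p ^ k).+1 + (n %/ p ^ k).+1);
        last by lia.
      by have := ltn_ceil n p0; lia.
    rewrite divn_small//.
    by apply: leq_trans (leq_pexp2l (prime_gt0 pp) kt); exact: trunc_log_ltn (prime_gt1 pp).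
  rewrite !big_split/= leq_add2r.
  have: \sum_(1 <= k < n.*2.+1) (k <= trunc_log p n.*2) <= minn n.*2 (trunc_log p n.*2).
    elim: n.*2 (trunc_log p n.*2) => [|m IH] t; first by rewrite big_geq.
    by rewrite big_nat_recr//=; have := IH t; lia.
  by lia.
have n2 : 0 < n.*2 by lia.
rewrite (maxn_idPl n2); apply: leq_trans (trunc_logP (prime_gt1 pp) n2).
by rewrite leq_exp2l ?prime_gt1.
Qed.

(** By [logn_central] no prime above [2 n] divides the coefficient, so its factorisation stops
    there. *)
Lemma central_leq_prod n :
  0 < n -> 'C(n.*2, n) <= \prod_(0 <= p < n.*2.+1 | prime p) p ^ logn p 'C(n.*2, n).
Proof.
move=> n0; set c := 'C(_, _); have c0 : 0 < c by rewrite bin_gt0; lia.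
have := @widen_partn (maxn c n.*2) predT c (leq_maxl _ _).
rewrite partnT// => {1}->; rewrite (@big_cat_nat _ _ _ n.*2.+1)//=; last by lia.
rewrite [X in _ * X]big1_seq => [|p /=]; last first.
  rewrite mem_index_iota => /andP[pn _].
  have [pp|pp] := boolP (prime p); last by rewrite lognE (negbTE pp).
  have := logn_central n pp; rewrite -/c (maxn_idPl _); last by lia.
  case: (logn p c) => // v; rewrite expnS => H.
  have : 0 < p ^ v by rewrite expn_gt0 prime_gt0.
  by nia.
rewrite muln1 (bigID prime)/= [X in _ * X]big1 ?muln1// => p pp.
by rewrite lognE (negbTE pp).
Qed.

(** Bounds what the factor [2 n + 1] and the primes up to [2 ^ k.+1] cost in [many_primes]. *)
Lemma small_correction k : 6 <= k -> 2 * k.+1 * (2 ^ k.+1 + 1) <= 4 ^ k.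
Proof.
elim: k => // k IH; rewrite leq_eqVlt => /orP[/eqP <-//|]; rewrite ltnS => /IH.
rewrite (expnS 4) (expnS 2 k.+1).
move: (2 ^ k.+1) (4 ^ k) => a b; nia.
Qed.

(* By [4 ^ n <= (2 n + 1) 'C(2 n, n)] with [2 n = 4 ^ k.+1], the primes of the
   central binomial coefficient have a large product. Those up to [2 ^ k.+1]
   contribute at most [2 n] each, those up to [4 ^ k] at most their primorial
   [4 ^ (4 ^ k)], half of the exponent; the rest comes from the upper window. *)
Lemma many_primes k : 6 <= k ->
  4 ^ k %/ (2 * k.+1) <=
  size [seq p <- index_iota (4 ^ k).+1 (4 ^ k.+1).+1 | prime p].
Proof.
move=> k6; set s := [seq _ <- _ | _].
pose n := 2 * 4 ^ k.
have n2E : n.*2 = 4 ^ k.+1 by rewrite expnS /n; lia.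
have e4 : 0 < 4 ^ k by rewrite expn_gt0.
have n0 : 0 < n by rewrite /n; lia.
have k24 : 2 ^ k.+1 <= 4 ^ k.
  by rewrite (_ : 4 = 2 ^ 2)// -expnM leq_exp2l//; lia.
have logb p : prime p -> p ^ logn p 'C(n.*2, n) <= 4 ^ k.+1.
  move=> pp; have := logn_central n pp; rewrite (maxn_idPl _) ?n2E//; lia.
have := leq_trans (expn4_leq_central n) (leq_mul (leqnn _) (central_leq_prod n0)).
rewrite {2}n2E (@big_cat_nat _ _ _ (4 ^ k).+1)//=; last by rewrite ltnS leq_exp2l.
rewrite (@big_cat_nat _ _ _ (2 ^ k.+1).+1)//=.
set P1 := \prod_(0 <= i < _ | _) _; set P2 := \prod_(_.+1 <= i < (4 ^ k).+1 | _) _.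
set P3 := \prod_(_ <= i < _ | _) _.
have b1 : P1 <= 4 ^ (k.+1 * 2 ^ k.+1).
  rewrite /P1 big_mkcond big_nat_recl//= mul1n big_mkord.
  apply: (@leq_trans (\prod_(i < 2 ^ k.+1) 4 ^ k.+1));
    last by rewrite prod_nat_const card_ord expnM.
  by apply: leq_prod => i _; case: ifP => [/logb//|_]; rewrite expn_gt0.
(* [2 ^ k.+1] is the square root of [2 n]: beyond it [p ^ 2] exceeds [2 n], so the valuation is at
   most 1. *)
have sq p : prime p -> 2 ^ k.+1 < p -> p ^ logn p 'C(n.*2, n) <= p.
  move=> pp kp; have h := logb p pp.
  have p2 : 4 ^ k.+1 < p ^ 2.
    by rewrite (_ : 4 = 2 ^ 2)// -expnM mulnC expnM ltn_sqr.
  have := leq_ltn_trans h p2; rewrite ltn_exp2l ?prime_gt1//.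
  by case: (logn _ _) => [|[|]]// _; rewrite ?expn0 ?expn1 ?prime_gt0.
have b2 : P2 <= 4 ^ (4 ^ k).
  apply: leq_trans (_ : _ <= 4 ^ (2 ^ (2 * k))) _; last by rewrite (expnM 2 2).
  apply: leq_trans (primorial_leq _).
  rewrite [leqRHS](@big_cat_nat _ _ _ (2 ^ k.+1).+1)//=; last first.
    by rewrite (expnM 2 2).
  rewrite -[leqLHS]mul1n leq_mul//.
    by rewrite big_seq_cond; apply: prodn_cond_gt0 => p /andP[_ /prime_gt0].
  rewrite expnM /P2 big_nat_cond [leqRHS]big_nat_cond.
  by apply: leq_prod => p /andP[/andP[h _] pp]; exact: sq.
have b3 : P3 <= 4 ^ (k.+1 * size s).
  rewrite /P3 -big_filter -/s expnM.
  have : all prime s by apply/allP => p; rewrite mem_filter => /andP[].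
  elim: s => [|p s IH]; first by rewrite big_nil.
  rewrite big_cons (expnS _ (size s)) => /= /andP[pp sp].
  by apply: leq_mul; [exact: logb | exact: IH].
have b0 : n.*2.+1 <= 4 ^ k.+2 by rewrite n2E expnS expnS; lia.
move=> /leq_trans /(_ (leq_mul b0 (leq_mul (leq_mul b1 b2) b3))).
(* The exponents of 4 give [2 * 4 ^ k <= k.+2 + k.+1 * 2 ^ k.+1 + 4 ^ k + k.+1 * size s]. By
   [small_correction] the small terms take at most half of [4 ^ k], plus 1, so that
   [4 ^ k <= 2 + 2 * k.+1 * size s]. *)
rewrite -!expnD leq_exp2l// /n => H.
have := small_correction k6 => H2.
by rewrite -ltnS ltn_divLR//; nia.
Qed.

Local Open Scope ring_scope.

(** * Exponential sums over the nodes *)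

Section minimum_over.
Context (d : nat) (S : {set 'I_d}) (F : 'I_d -> nat).

Lemma minimum_over_le j : j \in S -> (minimum_over S F <= F j)%N.
Proof.
rewrite /minimum_over => jS; move: (\max_(j in S) F j)%N => m.
have : j \in index_enum 'I_d by exact: mem_index_enum.
elim: (index_enum _) => // i r IH; rewrite big_cons inE => /predU1P[<-|/IH H].
  by rewrite jS geq_minl.
by case: ifP => // _; rewrite geq_min H orbT.
Qed.

(** The fold returns an entry or its seed. In the latter case the maximum is also a lower bound, so
    every entry over [S] equals it. *)
Lemma minimum_over_attained :
  (exists j, j \in S) -> exists2 j, j \in S & minimum_over S F = F j.
Proof.
case=> j0 j0S.
have : minimum_over S F = (\max_(j in S) F j)%N \/
    exists2 j, j \in S & minimum_over S F = F j.
  rewrite /minimum_over; elim/big_rec: _ => [|i x iS [->|[j jS ->]]]; first by left.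
  - by case: (leqP (F i) (\max_(j in S) F j)%N) => _; [right; exists i|left].
  - by right; case: (leqP (F i) (F j)) => _; [exists i|exists j].
case=> // E; exists j0 => //; apply/eqP; rewrite eqn_leq minimum_over_le//= E.
exact: (@leq_bigmax_cond _ (mem S) F).
Qed.

End minimum_over.

Section unit_char.
Local Open Scope complex_scope.
Context {R : realType}.

Definition unit_char (x : R) : R[i] := expi (2 * pi * x).

Lemma expi0 : expi (0 : R) = 1.
Proof. by rewrite /expi cos0 sin0. Qed.

Lemma expiD (a b : R) : expi (a + b) = expi a * expi b.
Proof. by rewrite /expi cosD sinD; simpc; congr (_ +i* _); ring. Qed.

Lemma normc_expi (a : R) : Normc.normc (expi a) = 1.
Proof. by rewrite /= cos2Dsin2 sqrtr1. Qed.

Lemma unit_charD (a b : R) : unit_char (a + b) = unit_char a * unit_char b.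
Proof. by rewrite /unit_char mulrDr expiD. Qed.

Lemma unit_char0 : unit_char 0 = 1.
Proof. by rewrite /unit_char mulr0 expi0. Qed.

Lemma unit_char_sum (I : Type) (r : seq I) (F : I -> R) :
  unit_char (\sum_(i <- r) F i) = \prod_(i <- r) unit_char (F i).
Proof. by apply: big_morph; [exact: unit_charD|exact: unit_char0]. Qed.

Lemma unit_charMn (a : R) n : unit_char (n%:R * a) = unit_char a ^+ n.
Proof.
elim: n => [|n IH]; first by rewrite mul0r unit_char0 expr0.
by rewrite -natr1 mulrDl mul1r unit_charD IH exprSr.
Qed.

Lemma unit_char_int (z : int) : unit_char z%:~R = 1.
Proof.
have nat1 (n : nat) : unit_char n%:R = 1.
  rewrite -[n%:R]mulr1 unit_charMn [X in X ^+ _](_ : _ = 1) ?expr1n//.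
  rewrite /unit_char mulr1 mulr_natl /expi.
  rewrite -[pi *+ 2]add0r cosD2pi sinD2pi cos0 sin0//.
case: z => n; first exact: nat1.
by rewrite NegzE -[LHS]mulr1 -(nat1 n.+1) -unit_charD rmorphN/= addNr unit_char0.
Qed.

Lemma normc_unit_char (a : R) : Normc.normc (unit_char a) = 1.
Proof. exact: normc_expi. Qed.

(** With [r] the remainder of [a], the half angle [s = pi r / p] lies in [[0, pi)]. There
    [cos (2 s) = 1] forces [sin s = 0], hence [r = 0]. *)
Lemma unit_char_eq1 (a : int) (p : nat) : (0 < p)%N ->
  unit_char (a%:~R / p%:R) = 1 -> (p%:Z %| a)%Z.
Proof.
move=> p0; set r := (a %% p)%Z.
have pn0 : p%:R != 0 :> R by rewrite pnatr_eq0; lia.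
have -> : a%:~R / p%:R = (a %/ p)%Z%:~R + r%:~R / p%:R :> R.
  rewrite {1}(divz_eq a p) -/r intrD intrM.
  by rewrite mulrDl -(pmulrn _ p) mulfK.
rewrite unit_charD unit_char_int mul1r.
have r0 : 0 <= r by rewrite modz_ge0//; lia.
have rp : r < p by rewrite ltz_pmod//.
rewrite /unit_char => H; apply/dvdz_mod0P/eqP; rewrite -/r; apply/negPn/negP => rn0.
set s : R := pi * (r%:~R / p%:R).
have : 0 < sin s.
  have rp0 : 0 < r%:~R :> R by rewrite ltr0z; lia.
  have pp0 : 0 < p%:R :> R by rewrite ltr0n.
  apply: sin_gt0_pi; rewrite mulr_gt0 ?pi_gt0 ?divr_gt0//=.
  rewrite -[ltRHS]mulr1 ltr_pM2l ?pi_gt0// ltr_pdivrMr// mul1r.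
  by rewrite pmulrn ltr_int.
have c1 : cos (s *+ 2) = 1.
  by move: H; rewrite -mulrA -/s mulr_natl /expi => -[].
have := cos2Dsin2 s; move: c1; rewrite cos_mulr2n.
by move: (cos s) (sin s) => c t; nra.
Qed.

(** If [p] does not divide [a], this is a geometric sum whose ratio is a [p]-th root of unity other
    than 1. *)
Lemma sum_unit_char (a : int) (p : nat) : (0 < p)%N ->
  \sum_(h < p) unit_char (h%:R * (a%:~R / p%:R)) = if (p%:Z %| a)%Z then p%:R else 0.
Proof.
move=> p0.
have pn0 : p%:R != 0 :> R by rewrite pnatr_eq0; lia.
case: ifPn => [/dvdzP[q ->]|pa].
  rewrite (eq_bigr (fun=> 1)) => [|h _]; first by rewrite sumr_const card_ord.
  by rewrite intrM -(pmulrn _ p) mulfK// unit_charMn unit_char_int expr1n.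
set z := unit_char (a%:~R / p%:R).
have z1 : z - 1 != 0.
  by rewrite subr_eq0; apply: contraNN pa => /eqP; exact: unit_char_eq1.
apply: (mulfI z1); rewrite mulr0.
rewrite (eq_bigr (fun h : 'I_p => z ^+ h)) => [|h _]; last by rewrite unit_charMn.
rewrite -subrX1 -unit_charMn mulrC divfK// unit_char_int subrr//.
Qed.

End unit_char.

Lemma supp_neq0 d (k : 'rV[int]_d) : k != 0 -> exists j, j \in supp k.
Proof.
move=> k0; have [j kj|E0] := pickP (fun j => k 0 j != 0); first by exists j; rewrite inE.
case/eqP: k0; apply/rowP => j; rewrite mxE; apply/eqP.
by have := E0 j => /negbFE.
Qed.

Definition moment d (k : 'rV[int]_d) (l : nat) : int := \sum_j k 0 j * (l ^ j)%N%:Z.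

(* Dividing [\sum_j k_j X^j] by the power of [X] of its lowest term and
   multiplying by [X], so that the root 0 is kept, leaves degree [width]. *)
Lemma card_moment_roots d (k : 'rV[int]_d) p : prime p ->
  (exists j, ~~ (p%:Z %| k 0%R j)%Z) ->
  (#|[pred l : 'I_p | (p%:Z %| moment k l)%Z]| <= width (supp k))%N.
Proof.
move=> pp [j pkj].
have pchar := pchar_Fp pp.
have inS i : ~~ (p%:Z %| k 0%R i)%Z -> i \in supp k.
  by rewrite inE; apply: contraNN => /eqP ->; exact: dvdz0.
have [j0 j0S mE] :=
  @minimum_over_attained _ (supp k) (@nat_of_ord d) (ex_intro _ j (inS _ pkj)).
have mle := @minimum_over_le _ (supp k) (@nat_of_ord d); rewrite mE in mle.
set q : {poly 'F_p} := \sum_(i in supp k) (k 0 i)%:~R *: 'X^((i - j0).+1).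
have coq i : i \in supp k -> q`_((i - j0).+1) = (k 0 i)%:~R.
  move=> iS; rewrite /q coef_sum (bigD1 i)//= coefZ coefXn eqxx mulr1 big1 ?addr0//.
  move=> i' /andP[i'S ni]; rewrite coefZ coefXn eqSS.
  have := mle _ iS; have := mle _ i'S => h1 h2.
  case: eqP => [E|]; last by rewrite mulr0.
  by case/eqP: ni; apply/val_inj => /=; lia.
have q0 : q != 0.
  apply/eqP => E; move/negP: (pkj); apply; rewrite (dvdz_pcharf pchar).
  by rewrite -(coq _ (inS _ pkj)) {1}E coef0.
have sq : (size q <= (width (supp k)).+1)%N.
  apply: (leq_trans (size_sum _ _ _)); apply/bigmax_leqP => i iS.
  apply: (leq_trans (size_scale_leq _ _)); rewrite size_polyXn /width mE.
  have : (i <= \max_(j in supp k) j)%N by exact: (@leq_bigmax_cond _ (mem (supp k))).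
  by have := mle _ iS; lia.
set A := [pred l : 'I_p | _].
have momE (l : 'I_p) :
    (moment k l)%:~R = \sum_(i in supp k) (k 0 i)%:~R * l%:R ^+ i :> 'F_p.
  rewrite /moment rmorph_sum/= [LHS](bigID (mem (supp k)))/= [X in _ + X]big1 ?addr0.
    by apply: eq_bigr => i _; rewrite intrM -pmulrn natrX.
  by move=> i; rewrite inE negbK => /eqP ->; rewrite mul0r.
pose rs := [seq (l%:R : 'F_p) | l : 'I_p <- enum A].
have : (size rs < size q)%N.
  apply: max_poly_roots => //.
    apply/allP => x /mapP[l]; rewrite mem_enum inE (dvdz_pcharf pchar) momE => /eqP M0 ->.
    (* [q] has no constant term, so 0 is a root. For nonzero [l], [l ^ j0 * q(l)] is [l] times the
       moment, which vanishes modulo [p]. *)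
    have [->|l0] := eqVneq (l%:R : 'F_p) 0.
      by rewrite /root /q horner_sum big1// => i _; rewrite hornerZ hornerXn expr0n mulr0.
    have lj0 : (l%:R : 'F_p) ^+ j0 != 0 by rewrite expf_neq0.
    rewrite /root -(mulrI_eq0 _ (mulfI lj0)).
    have := congr1 (fun u => l%:R * u) M0; rewrite /= mulr0 => <-.
    rewrite /q horner_sum !mulr_sumr; apply/eqP; apply: eq_bigr => i iS.
    rewrite hornerZ hornerXn mulrCA [RHS]mulrCA -exprD -exprS.
    by congr (_ * _ ^+ _); have := mle _ iS; lia.
  rewrite map_inj_in_uniq ?enum_uniq// => l l' _ _ /(congr1 val).
  by rewrite /= !val_Fp_nat// !modn_small// => /val_inj.
by rewrite size_map -cardE => /leq_trans /(_ sq); rewrite ltnS.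
Qed.

(** * Nodes of one prime and their exponential sums *)

Section korobov.
Local Open Scope complex_scope.
Context {R : realType}.
Implicit Types (d p h l : nat).

(* The shift by [1 / (2 p)] only changes phases, and keeps the nodes in the open
   cube, where smoothing an integrable function recovers its values. *)
Definition korobov_point d p h l : 'rV[R]_d :=
  \row_(j < d) ((((h * l ^ j) %% p)%N%:R + 2^-1) / p%:R).

Lemma korobov_point_itv d p h l (j : 'I_d) : (0 < p)%N ->
  0 < korobov_point d p h l 0 j < 1.
Proof.
move=> p0; rewrite mxE; have pp : 0 < p%:R :> R by rewrite ltr0n.
have := ltn_pmod (h * l ^ j) p0; move: (_ %% p)%N => r rp.
have r0 : 0 <= r%:R :> R by [].
apply/andP; split; first by rewrite divr_gt0//; lra.
rewrite ltr_pdivrMr// mul1r.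
have : r.+1%:R <= p%:R :> R by rewrite ler_nat.
by rewrite -natr1; lra.
Qed.

(** The effect of the shift does not depend on [h] or [l], so it leaves the sum over the nodes as a
    factor of modulus 1. *)
Definition korobov_phase d (k : 'rV[int]_d) p : R :=
  \sum_j (k 0 j)%:~R * (2^-1 / p%:R).

Lemma unit_char_korobov d (k : 'rV[int]_d) p h l : (0 < p)%N ->
  unit_char (dotp k (korobov_point d p h l)) =
  unit_char (korobov_phase k p) * unit_char (h%:R * ((moment k l)%:~R / p%:R)).
Proof.
move=> p0; rewrite -unit_charD /dotp /korobov_phase.
have pn0 : p%:R != 0 :> R by rewrite pnatr_eq0; lia.
(* Reducing [h l^j] modulo [p] drops integer quotients from the node; adding back their pairing with
   [k] leaves the character unchanged. *)
transitivity (unit_char (\sum_j (k 0 j)%:~R * korobov_point d p h l 0 j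
   + (\sum_j k 0 j * ((h * l ^ j) %/ p)%N%:Z)%:~R : R)).
  by rewrite unit_charD unit_char_int mulr1.
congr unit_char; rewrite rmorph_sum -big_split/=.
rewrite /moment rmorph_sum/= mulr_suml mulr_sumr -big_split/=.
apply: eq_bigr => j _; rewrite mxE !intrM -!pmulrn.
have : (h * l ^ j)%N%:R / p%:R =
    ((h * l ^ j) %/ p)%N%:R + ((h * l ^ j) %% p)%N%:R / p%:R :> R.
  by rewrite {1}(divn_eq (h * l ^ j) p) natrD natrM mulrDl mulfK.
move=> E; rewrite mulrA [h%:R * _]mulrCA -natrM -mulrA E.
by ring.
Qed.

Lemma normc_sum (I : Type) (r : seq I) (P : pred I) (F : I -> R[i]) :
  Normc.normc (\sum_(i <- r | P i) F i) <= \sum_(i <- r | P i) Normc.normc (F i).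
Proof.
elim/big_ind2: _ => [|x a y b xa yb|//]; first by rewrite Normc.normc0.
exact: le_trans (le_normcD _ _) (lerD xa yb).
Qed.

Lemma normc_nat n : Normc.normc (n%:R : R[i]) = n%:R.
Proof. by rewrite normcMn Normc.normc1. Qed.

Definition min_freq d (k : 'rV[int]_d) := minimum_over (supp k) (fun j => `|k 0%R j|%N).

(** Summing over [h] first leaves [p] times the number of [l] at which [p] divides the moment. If
    [p] divides every [k_j], it divides the least of their absolute values, and the trivial count
    [p] is used. *)
Lemma normc_korobov_sum d (k : 'rV[int]_d) p : prime p -> k != 0 ->
  Normc.normc (\sum_(h < p) \sum_(l < p) unit_char (dotp k (korobov_point d p h l)))
    <= p%:R * (width (supp k) + p * (p %| min_freq k))%N%:R.
Proof.
move=> pp k0; have p0 := prime_gt0 pp.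
rewrite exchange_big/=.
have E (l : 'I_p) : \sum_(h < p) unit_char (dotp k (korobov_point d p h l)) =
    unit_char (korobov_phase k p) * (if (p%:Z %| moment k l)%Z then p%:R else 0).
  by rewrite -sum_unit_char// mulr_sumr; apply: eq_bigr => h _; exact: unit_char_korobov.
under eq_bigr do rewrite E.
rewrite -mulr_sumr Normc.normcM normc_unit_char mul1r.
rewrite -big_mkcond/= sumr_const -mulrnA normc_nat -natrM ler_nat leq_mul2l.
apply/orP; right.
have [H|H] := boolP [forall j, (p%:Z %| k 0%R j)%Z].
  have -> : (p %| min_freq k)%N.
    rewrite /min_freq.
    have [j' _ ->] :=
      @minimum_over_attained _ (supp k) (fun j => `|k 0%R j|%N) (supp_neq0 k0).
    exact: (forallP H j').
  rewrite muln1; apply: leq_trans (leq_addl _ _).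
  by rewrite (leq_trans (max_card _))// card_ord.
apply: leq_trans (leq_addr _ _); apply: card_moment_roots => //.
by move: H; rewrite negb_forall => /existsP.
Qed.

End korobov.

(** * Integration over the cube and smoothing *)

Section product_integral.
Local Open Scope classical_set_scope.
Context {R : realType}.
Local Notation tupleR n := (n.-tuple (measurableTypeR R)).
Local Notation leb := (@lebesgue_measure R).

Lemma measurable_prod_tnth n (phi : 'I_n -> R -> R) :
  (forall i, measurable_fun setT (phi i)) ->
  measurable_fun setT (fun t : tupleR n => \prod_i phi i (tnth t i)).
Proof.
move=> mphi; apply: measurable_prod => i _.
exact: (measurableT_comp (mphi i) (measurable_tnth i)).
Qed.

(** Tonelli, peeling off the first coordinate; nonnegativity spares any integrability condition. *)
Lemma integral_prod_tnth n (phi : 'I_n -> R -> R) (v : 'I_n -> R) :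
  (forall i, measurable_fun setT (phi i)) -> (forall i x, 0 <= phi i x) ->
  (forall i, (\int[leb]_x (phi i x)%:E = (v i)%:E)%E) ->
  (\int[lebesgue_tuple n]_t (\prod_i phi i (tnth t i))%:E = (\prod_i v i)%:E)%E.
Proof.
elim: n phi v => [|n IH] phi v mphi phi0 iphi.
  rewrite /= integral_dirac// ?diracT ?mul1e ?big_ord0//.
  by apply/measurable_EFinP; exact: measurable_prod_tnth.
rewrite [lebesgue_tuple n.+1]/= ge0_integral_pushforward//; first last.
- by move=> t _; rewrite lee_fin prodr_ge0.
- by apply/measurable_EFinP; exact: measurable_prod_tnth.
- exact: measurable_tcons.
rewrite preimage_setT fubini_tonelli1; first last.
- by move=> t /=; rewrite lee_fin prodr_ge0.
- apply/measurable_EFinP; apply: (measurableT_comp (measurable_prod_tnth mphi)).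
  exact: measurable_tcons.
have v0 i : 0 <= v i by rewrite -lee_fin -iphi integral_ge0// => x _; rewrite lee_fin.
pose w := \prod_i v (lift ord0 i).
transitivity (\int[leb]_x (w%:E * (phi ord0 x)%:E))%E.
  apply: eq_integral => x _.
  rewrite /fubini_F /= muleC -(IH (fun i => phi (lift ord0 i)))//.
  rewrite -ge0_integralZl ?lee_fin//.
  - apply: eq_integral => y _; rewrite big_ord_recl EFinM tnth0; congr (_ * _%:E)%E.
    by apply: eq_bigr => i _; congr (phi _ _); exact: tnthS.
  - apply/measurable_EFinP; exact: (@measurable_prod_tnth _ (fun i => phi (lift ord0 i))).
  - by move=> y _; rewrite lee_fin prodr_ge0.
rewrite ge0_integralZl ?lee_fin ?prodr_ge0//; first last.
- by move=> x _; rewrite lee_fin.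
- by apply/measurable_EFinP; exact: mphi.
by rewrite iphi -EFinM big_ord_recl mulrC.
Qed.

Lemma cube_tuple_bigcap d : @row_of_tuple R d @^-1` @unit_cube R d =
  \bigcap_(i in [set: 'I_d]) (fun t : tupleR d => tnth t i) @^-1` `[0, 1[%classic.
Proof.
apply/seteqP; split=> t /= h i => [_|]; first by have := h i; rewrite mxE /= in_itv.
by rewrite mxE; have := h i I; rewrite /= in_itv.
Qed.

Lemma measurable_cube d :
  measurable (@row_of_tuple R d @^-1` @unit_cube R d : set (tupleR d)).
Proof.
rewrite cube_tuple_bigcap; apply: fin_bigcap_measurable; first exact: finite_finset.
move=> i _; rewrite -[X in measurable X]setTI; exact: measurable_tnth.
Qed.

(** Cutting every factor off outside [[0, 1)] cuts the product off outside the cube. *)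
Lemma integral_cube_prod d (phi : 'I_d -> R -> R) (v : 'I_d -> R) :
  (forall i, measurable_fun setT (phi i)) -> (forall i x, 0 <= phi i x) ->
  (forall i, (\int[leb]_(x in `[0%R, 1%R[) (phi i x)%:E = (v i)%:E)%E) ->
  (\int[lebesgue_tuple d]_(t in @row_of_tuple R d @^-1` @unit_cube R d)
     (\prod_i phi i (tnth t i))%:E = (\prod_i v i)%:E)%E.
Proof.
move=> mphi phi0 iphi.
rewrite -(@integral_prod_tnth _ (fun i => phi i \_ `[0, 1[)); first last.
- by move=> i; rewrite -iphi [in RHS]integral_mkcond; congr integral; rewrite restrict_EFin.
- by move=> i x; rewrite patchE; case: ifP.
- by move=> i; apply/(measurable_restrictT _ _).1 => //; exact: measurable_funTS.
rewrite integral_mkcond; apply: eq_integral => t _; rewrite patchE.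
case: ifPn => [/set_mem tD|tD].
  congr EFin; apply: eq_bigr => i _; rewrite patchE mem_set//.
  by have := tD i; rewrite mxE /= in_itv.
have [i ti] : exists i, ~ (0 <= tnth t i < 1).
  apply/not_existsP => h; move/negP: tD; apply; rewrite inE => i /=.
  by rewrite mxE; apply: contrapT; exact: h.
rewrite (bigD1 i)//= patchE memNset ?mul0r// /= in_itv/=; exact/negP.
Qed.

Lemma lebesgue_tuple_cube d :
  (lebesgue_tuple d (@row_of_tuple R d @^-1` @unit_cube R d) = 1)%E.
Proof.
have := @integral_cube_prod d (fun _ _ => 1) (fun=> 1) _ _ _.
rewrite !big1// => <-//; last first.
  move=> i; rewrite integral_cst//= lebesgue_measure_itv/=.
  by rewrite lte_fin ltr01 mul1e -EFinB subr0.
rewrite -[LHS]mul1e -integral_cst; last exact: measurable_cube.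
by [].
Qed.

End product_integral.

(** * The one-dimensional kernel *)

Section peak.
Local Open Scope classical_set_scope.
Context {R : realType}.
Local Notation leb := (@lebesgue_measure R).

Lemma integral_cos_int (z : int) (a : R) :
  (\int[leb]_(x in `[0%R, 1%R[) (cos (2 * pi * (z%:~R * (a - x))))%:E =
   ((z == 0)%:R : R)%:E)%E.
Proof.
have [->|z0] := eqVneq z 0.
  under eq_integral do rewrite mul0r mulr0 cos0.
  by rewrite integral_cst//= lebesgue_measure_itv/= lte_fin ltr01 mul1e -EFinB subr0.
have zR : z%:~R != 0 :> R by rewrite intr_eq0.
set c : R := 2 * pi * z%:~R.
have c0 : c != 0 by rewrite !mulf_neq0// gt_eqF// pi_gt0.
pose F x : R := - sin (c * (a - x)) / c.
have dF (x : R) : is_derive x 1 F (cos (c * (a - x))).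
  rewrite /F; apply: is_derive_eq.
  by rewrite /GRing.scale/=; field.
have cF : continuous F.
  by move=> x; apply: differentiable_continuous; apply/derivable1_diffP; have [] := dF x.
have cf : continuous (fun x : R => cos (c * (a - x))).
  move=> x; apply: differentiable_continuous; apply/derivable1_diffP.
  have [] // : is_derive x (1 : R) (fun x => cos (c * (a - x))) (c * sin (c * (a - x))).
  by apply: is_derive_eq; rewrite /GRing.scale/=; ring.
under eq_integral do rewrite mulrA -/c.
rewrite integral_itv_bndo_bndc; last first.
  by apply/measurable_EFinP; apply: measurable_funTS; exact: continuous_measurable_fun.
rewrite (@continuous_FTC2 _ (fun x => cos (c * (a - x))) F)//.
- rewrite -EFinB /F; congr EFin; rewrite -mulrBl -[RHS](mul0r c^-1); congr (_ / _).
  (* The primitive takes equal values at 0 and 1 by periodicity; the sines are the imaginary parts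
     of these characters. *)
  have : unit_char (z%:~R * a) = unit_char (z%:~R * (a - 1)).
    by rewrite mulrBr mulr1 unit_charD -rmorphN unit_char_int mulr1.
  by rewrite /unit_char !mulrA -/c subr0 => -[_ ->]; rewrite opprK addNr.
- exact: continuous_subspaceT.
- split; first by move=> x _; have [] := dF x.
    exact/cvg_at_right_filter/cF.
  exact/cvg_at_left_filter/cF.
- by move=> x _; rewrite derive1E; have [_ ->] := dF x.
Qed.

Local Open Scope complex_scope.

(* Unlike the Fejer kernel, its tensor powers tend to 0 uniformly away from the
   integer lattice: off the lattice they decay geometrically in [N], whereas
   their integrals decay only polynomially. *)
Definition peak (N : nat) (y : R) : R := ((1 + cos (2 * pi * y)) / 2) ^+ N.

(** The Fourier coefficient of [peak N] at frequency [m - N]. *)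
Definition peak_coef (N m : nat) : R := 'C(N.*2, m)%:R / 4 ^+ N.

(** With [z] the character at [y], [(1 + cos (2 pi y)) / 2 = (1 + z)^2 / (4 z)]; the binomial
    theorem expands its [N]-th power. *)
Lemma peak_unit_char N y : (peak N y)%:C =
  \sum_(m < N.*2.+1) (peak_coef N m)%:C * unit_char ((m%:Z - N%:Z)%:~R * y).
Proof.
set z := unit_char y; set w := unit_char (- y).
have wz : w * z = 1 by rewrite -unit_charD addNr unit_char0.
transitivity ((4 ^+ N)^-1 * (w * (1 + z) ^+ 2) ^+ N).
  rewrite /peak rmorphXn/= -exprVn -exprMn; congr (_ ^+ _).
  have -> : w * (1 + z) ^+ 2 = z + w + 2.
    by rewrite (_ : _ * _ = w + 2 * (w * z) + (w * z) * z); [rewrite wz; ring|ring].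
  have -> : z + w = (2 * cos (2 * pi * y))%:C.
    rewrite /z /w /unit_char mulrN /expi cosN sinN; simpc.
    by apply/eqP; rewrite eq_complex /=; apply/andP; split; apply/eqP; ring.
  by rewrite !rmorphM/= rmorphD/= fmorphV/= rmorph1 !rmorph_nat; field.
rewrite exprMn -exprM mul2n [(1 + z) ^+ _]exprDn !mulr_sumr; apply: eq_bigr => m _.
have -> : unit_char ((m%:Z - N%:Z)%:~R * y) = z ^+ m * w ^+ N.
  by rewrite -!unit_charMn -unit_charD; congr unit_char; rewrite intrB -!pmulrn; ring.
rewrite /peak_coef rmorphM/= fmorphV/= rmorphXn/= !rmorph_nat expr1n.
by rewrite -[1 * _ *+ _]mulr_natl; ring.
Qed.

Lemma peak_cos N y :
  peak N y = \sum_(m < N.*2.+1) peak_coef N m * cos (2 * pi * ((m%:Z - N%:Z)%:~R * y)).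
Proof.
have := congr1 (@complex.Re R) (peak_unit_char N y); rewrite /= => ->.
rewrite (raddf_sum (@complex.Re R : Rcomplex R -> R)).
by apply: eq_bigr => m _; rewrite /unit_char /expi; simpc.
Qed.

Lemma measurable_cos_affine (c a : R) :
  measurable_fun setT (fun x : R => cos (c * (a - x))).
Proof.
apply: (measurableT_comp (continuous_measurable_fun (@continuous_cos R))).
by apply: measurable_funM => //; apply: measurable_funB.
Qed.

Lemma measurable_peak N (a : R) : measurable_fun setT (fun x : R => peak N (a - x)).
Proof.
apply: measurable_funX; apply: measurable_funM => //; apply: measurable_funD => //.
exact: measurable_cos_affine.
Qed.

Lemma peak_ge0 N y : 0 <= peak N y.
Proof. by rewrite exprn_ge0// divr_ge0// -[1]opprK addrC subr_ge0 cos_geN1. Qed.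

(** Among the frequencies [m - N], only the middle one, 0, has a nonzero integral. *)
Lemma integral_peak N (a : R) :
  (\int[leb]_(x in `[0%R, 1%R[) (peak N (a - x))%:E = (peak_coef N N)%:E)%E.
Proof.
have If (z : int) :
    leb.-integrable `[0%R, 1%R[ (fun x => (cos (2 * pi * (z%:~R * (a - x))))%:E).
  have := @measurable_bounded_integrable _ (measurableTypeR R) R leb
    (fun x => cos (2 * pi * (z%:~R * (a - x)))) `[0%R, 1%R[%classic; apply => //=.
  - by rewrite lebesgue_measure_itv/= lte_fin ltr01 -EFinB ltry.
  - apply: measurable_funTS; have := measurable_cos_affine (2 * pi * z%:~R) a.
    by under eq_fun do rewrite -mulrA.
  - exists 1; split; first by rewrite num_real.
    by move=> M M1 x _ /=; rewrite (le_trans (cos_max _))// ltW.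
under eq_integral do rewrite peak_cos -sumEFin.
rewrite integral_sum//=; last first.
  move=> m; exact: (@integrableZl _ _ _ leb _ (measurable_itv _)
    (peak_coef N m) _ (If (m%:Z - N%:Z))).
have NN : (N < N.*2.+1)%N by lia.
rewrite (bigD1 (Ordinal NN))//=; rewrite [X in (_ + X)%E]big1 => [|m mN].
  under eq_integral do rewrite EFinM.
  by rewrite integralZl// integral_cos_int subrr eqxx mule1 adde0.
under eq_integral do rewrite EFinM.
rewrite integralZl// integral_cos_int subr_eq0 eqz_nat.
by move: mN; rewrite -val_eqE /= => /negbTE ->; rewrite mule0.
Qed.

End peak.

Section cube_integral_theory.
Local Open Scope classical_set_scope.
Context {R : realType} (d : nat).
Local Notation tupleR n := (n.-tuple (measurableTypeR R)).
Implicit Types (f g h : 'rV[R]_d -> R).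

Definition cube_measurable h := measurable_fun setT (h \o @row_of_tuple R d).

Lemma cube_integrableMl f h (M : R) : cube_integrable f -> cube_measurable h ->
  (forall x, `|h x| <= M) -> cube_integrable (fun x => f x * h x).
Proof.
move=> fi mh hM.
have := integrableMl (@measurable_cube R d) fi (h := h \o @row_of_tuple R d); apply.
  exact: measurable_funTS.
by exists M; split; rewrite ?num_real// => K MK t _ /=; rewrite (le_trans (hM _))// ltW.
Qed.

Lemma cube_integrable_bounded h (M : R) : cube_measurable h ->
  (forall x, `|h x| <= M) -> cube_integrable h.
Proof.
move=> mh hM.
have := measurable_bounded_integrable (@measurable_cube R d)
  (f := h \o @row_of_tuple R d) (mu := lebesgue_tuple d); apply.
- apply: le_lt_trans (ltry 1); rewrite le_eqVlt; apply/orP; left; apply/eqP.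
  exact: lebesgue_tuple_cube.
- exact: measurable_funTS.
by exists M; split; rewrite ?num_real// => K MK t _ /=; rewrite (le_trans (hM _))// ltW.
Qed.

Lemma eq_cube_integral f g : f =1 g -> cube_integral f = cube_integral g.
Proof. by move=> fg; apply: eq_Rintegral => t _; rewrite fg. Qed.

Lemma cube_integralD f g : cube_integrable f -> cube_integrable g ->
  cube_integral (fun x => f x + g x) = cube_integral f + cube_integral g.
Proof. by move=> fi gi; apply: RintegralD => //; exact: measurable_cube. Qed.

Lemma cube_integrableD f g : cube_integrable f -> cube_integrable g ->
  cube_integrable (fun x => f x + g x).
Proof.
move=> fi gi; have := integrableD (@measurable_cube R d) fi gi.
by apply: eq_integrable => //; exact: measurable_cube.
Qed.

Lemma cube_integrableZl (a : R) f : cube_integrable f -> cube_integrable (fun x => a * f x).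
Proof. by move=> fi; have := integrableZl (@measurable_cube R d) a fi. Qed.

Lemma cube_integralZl (a : R) f : cube_integrable f ->
  cube_integral (fun x => a * f x) = a * cube_integral f.
Proof. by move=> fi; apply: RintegralZl => //; exact: measurable_cube. Qed.

Lemma cube_integral0 : cube_integral (fun _ : 'rV[R]_d => 0) = 0.
Proof. by rewrite /cube_integral Rintegral_cst ?mul0r//; exact: measurable_cube. Qed.

Lemma cube_integrable0 : cube_integrable (fun _ : 'rV[R]_d => 0).
Proof.
apply: (@cube_integrable_bounded _ 0) => [|x]; rewrite ?normr0//; exact: measurable_cst.
Qed.

Lemma cube_integral_sum (I : Type) (r : seq I) (F : I -> 'rV[R]_d -> R) :
  (forall i, cube_integrable (F i)) ->
  cube_integrable (fun x => \sum_(i <- r) F i x) /\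
  cube_integral (fun x => \sum_(i <- r) F i x) = \sum_(i <- r) cube_integral (F i).
Proof.
move=> Fi; elim: r => [|i r [IHi IH]].
  rewrite big_nil; split; last first.
    by rewrite (eq_cube_integral (g := fun=> 0)) ?cube_integral0// => x; rewrite big_nil.
  by under eq_fun do rewrite big_nil; exact: cube_integrable0.
rewrite big_cons -IH -cube_integralD//; split.
  by under eq_fun do rewrite big_cons; exact: cube_integrableD.
by apply: eq_cube_integral => x; rewrite big_cons.
Qed.

Lemma le_cube_integral f g : cube_integrable f -> cube_integrable g ->
  (forall x, unit_cube x -> f x <= g x) -> cube_integral f <= cube_integral g.
Proof.
move=> fi gi fg; apply: le_Rintegral => //; first exact: measurable_cube.
by move=> t Dt; exact: fg.
Qed.

Lemma normr_cube_integral f : cube_integrable f ->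
  `|cube_integral f| <= cube_integral (fun x => `|f x|).
Proof. by move=> fi; apply: le_normr_Rintegral => //; exact: measurable_cube. Qed.

Lemma cube_integrable_norm f : cube_integrable f -> cube_integrable (fun x => `|f x|).
Proof. by move=> fi; exact: (integrable_norm fi). Qed.

End cube_integral_theory.

(** * The tensor kernel and its action on Fourier coefficients *)

Section kernel.
Local Open Scope classical_set_scope.
Context {R : realType} (d : nat).
Local Open Scope complex_scope.
Implicit Types (f : 'rV[R]_d -> R) (k : 'rV[int]_d) (x y : 'rV[R]_d) (N : nat).

Lemma Re_sum (I : Type) (r : seq I) (F : I -> R[i]) :
  complex.Re (\sum_(i <- r) F i) = \sum_(i <- r) complex.Re (F i).
Proof. exact: (raddf_sum (@complex.Re R : Rcomplex R -> R)). Qed.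

Lemma Re_scale (a : R) (z : R[i]) : complex.Re (a%:C * z) = a * complex.Re z.
Proof. by case: z => u v; simpc. Qed.

Lemma normc_ge0 (z : R[i]) : 0 <= Normc.normc z.
Proof. by case: z => a b; exact: sqrtr_ge0. Qed.

Lemma normr_Re_le (z : R[i]) : `|complex.Re z| <= Normc.normc z.
Proof. by case: z => a b /=; rewrite -sqrtr_sqr ler_wsqrtr// lerDl sqr_ge0. Qed.

Lemma cube_measurable_dotp k : cube_measurable (@dotp R d k).
Proof.
rewrite /cube_measurable /dotp; apply: measurable_sum => i.
apply: measurable_funM => //=.
have := @measurable_tnth _ (measurableTypeR R) d i.
by apply: eq_measurable_fun => t _; rewrite mxE.
Qed.

Lemma dotpB k x y : dotp k (x - y) = dotp k x - dotp k y.
Proof. by rewrite /dotp -sumrB; apply: eq_bigr => i _; rewrite !mxE mulrBr. Qed.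

Lemma cube_measurable_cos_dotp k (a c : R) :
  cube_measurable (fun x => cos (c * (a - dotp k x))).
Proof.
apply: (measurableT_comp (continuous_measurable_fun (@continuous_cos R))).
apply: measurable_funM => //; apply: measurable_funB => //; exact: cube_measurable_dotp.
Qed.

Lemma cube_measurable_sin_dotp k (a c : R) :
  cube_measurable (fun x => sin (c * (a - dotp k x))).
Proof.
apply: (measurableT_comp (continuous_measurable_fun (@continuous_sin R))).
apply: measurable_funM => //; apply: measurable_funB => //; exact: cube_measurable_dotp.
Qed.

Lemma fourier_coefE f k :
  fourier_coef f k = cube_integral (fun x => f x * cos (2 * pi * (0 - dotp k x))) +i*
    cube_integral (fun x => f x * sin (2 * pi * (0 - dotp k x))).
Proof.
rewrite /fourier_coef /cube_integralC; congr (_ +i* _); apply: eq_cube_integral => x.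
  by rewrite sub0r -mulrN mulrN /=; ring.
by rewrite sub0r -mulrN mulrN /=; ring.
Qed.

Lemma Re_fourier_coef f k x0 : cube_integrable f ->
  complex.Re (fourier_coef f k * unit_char (dotp k x0)) =
  cube_integral (fun x => f x * cos (2 * pi * dotp k (x0 - x))).
Proof.
move=> fi; rewrite fourier_coefE /unit_char /expi.
set c := cos (2 * pi * _); set s := sin (2 * pi * _); simpc => /=.
set F := fun x => _; set G := fun x => _.
have iF : cube_integrable F.
  apply: (cube_integrableMl (M := 1) fi) => [|x]; last exact: cos_max.
  exact: cube_measurable_cos_dotp.
have iG : cube_integrable G.
  apply: (cube_integrableMl (M := 1) fi) => [|x]; last exact: sin_max.
  exact: cube_measurable_sin_dotp.
rewrite mulrC [_ * s]mulrC -mulNr -!cube_integralZl// -cube_integralD//;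
  try exact: cube_integrableZl.
apply: eq_cube_integral => x; rewrite /F /G dotpB.
have -> : 2 * pi * (dotp k x0 - dotp k x) =
    2 * pi * dotp k x0 + 2 * pi * (0 - dotp k x) :> R by ring.
by rewrite cosD -/c -/s; ring.
Qed.

Definition cube_kernel N y : R := \prod_j peak N (y 0 j).

Definition kernel_freq N (g : {ffun 'I_d -> 'I_N.*2.+1}) : 'rV[int]_d :=
  \row_j ((g j)%:Z - N%:Z).

Definition kernel_coef N (g : {ffun 'I_d -> 'I_N.*2.+1}) : R := \prod_j peak_coef N (g j).

Lemma kernel_unit_char N y :
  (cube_kernel N y)%:C =
  \sum_g (kernel_coef g)%:C * unit_char (dotp (kernel_freq (N := N) g) y).
Proof.
rewrite rmorph_prod/=; under eq_bigr do rewrite peak_unit_char.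
rewrite bigA_distr_bigA/=; apply: eq_bigr => g _.
rewrite big_split/= rmorph_prod; congr (_ * _).
by rewrite /dotp unit_char_sum; apply: eq_bigr => j _; rewrite mxE.
Qed.

Lemma kernel_cos N y :
  cube_kernel N y = \sum_g kernel_coef g * cos (2 * pi * dotp (kernel_freq (N := N) g) y).
Proof.
have := congr1 (@complex.Re R) (kernel_unit_char N y); rewrite /= => ->.
by rewrite Re_sum; apply: eq_bigr => m _; rewrite Re_scale.
Qed.

(** Convolution with the kernel, before division by [kernel_mass]. *)
Definition smoothing f N x0 : R := cube_integral (fun x => f x * cube_kernel N (x0 - x)).

(** The kernel is a finite sum of cosines, so integrating termwise avoids any question of
    convergence of the Fourier series of [f]. *)
Lemma smoothingE f N x0 : cube_integrable f ->
  smoothing f N x0 = \sum_g kernel_coef g *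
    complex.Re (fourier_coef f (kernel_freq (N := N) g) *
                unit_char (dotp (kernel_freq g) x0)).
Proof.
move=> fi.
have ig (g : {ffun 'I_d -> 'I_N.*2.+1}) :
    cube_integrable (fun x => f x * cos (2 * pi * dotp (kernel_freq g) (x0 - x))).
  apply: (cube_integrableMl (M := 1) fi) => [|x]; last exact: cos_max.
  under [X in cube_measurable X]eq_fun do rewrite dotpB.
  exact: cube_measurable_cos_dotp.
under eq_bigr do rewrite Re_fourier_coef// -cube_integralZl//.
rewrite -(cube_integral_sum _ (fun g => cube_integrableZl _ (ig g))).2.
apply: eq_cube_integral => x; rewrite kernel_cos mulr_sumr.
by apply: eq_bigr => g _; rewrite mulrCA.
Qed.

Lemma kernel_freq_inj N : injective (@kernel_freq N).
Proof.
move=> g g' /rowP E; apply/ffunP => j; apply/val_inj => /=.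
by have := E j; rewrite !mxE => /addIr [].
Qed.

Lemma kernel_coef_ge0 N (g : {ffun 'I_d -> 'I_N.*2.+1}) : 0 <= kernel_coef g.
Proof. by rewrite prodr_ge0// => j _; rewrite divr_ge0// exprn_ge0. Qed.

(** Both the integral of the kernel over the cube and its Fourier coefficient at frequency 0, the
    largest one. *)
Definition kernel_mass N : R := peak_coef N N ^+ d.

Lemma kernel_mass_gt0 N : 0 < kernel_mass N.
Proof.
rewrite exprn_gt0// divr_gt0 ?exprn_gt0// ltr0n bin_gt0 -addnn; exact: leq_addr.
Qed.

Lemma kernel_coef_le N (g : {ffun 'I_d -> 'I_N.*2.+1}) : kernel_coef g <= kernel_mass N.
Proof.
rewrite /kernel_mass -[d in X in _ <= X]card_ord -prodr_const ler_prod// => j _.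
rewrite divr_ge0 ?exprn_ge0//= ler_pM2r ?invr_gt0 ?exprn_gt0//.
by rewrite ler_nat leq_bin_central.
Qed.

Definition kernel_freq_center N : {ffun 'I_d -> 'I_N.*2.+1} := [ffun=> inord N].

Lemma kernel_freq0 N : kernel_freq (kernel_freq_center N) = 0.
Proof. by apply/rowP => j; rewrite !mxE ffunE inordK ?subrr//; lia. Qed.

Lemma kernel_coef0 N : kernel_coef (kernel_freq_center N) = kernel_mass N.
Proof.
rewrite /kernel_coef (eq_bigr (fun=> peak_coef N N)) ?prodr_const ?card_ord// => j _.
by rewrite ffunE inordK//; lia.
Qed.

Lemma fourier_coef0 f : complex.Re (fourier_coef f 0) = cube_integral f.
Proof.
rewrite fourier_coefE /=; apply: eq_cube_integral => x.
by rewrite /dotp big1 ?subr0 ?mulr0 ?cos0 ?mulr1// => i _; rewrite mxE mul0r.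
Qed.

(** The frequencies of the kernel are pairwise distinct, so this is a finite partial sum of the
    norm. *)
Lemma weighted_norm_sum_le (r : 'rV[int]_d -> R) f N :
  (forall k, 0 <= r k) -> (weighted_norm r f <= 1)%E ->
  \sum_(g : {ffun 'I_d -> 'I_N.*2.+1})
    Normc.normc (fourier_coef f (kernel_freq g)) * r (kernel_freq g) <= 1.
Proof.
move=> r0; rewrite -lee_fin; apply: le_trans; apply: esum_ge.
set s := [seq kernel_freq g | g <- enum {ffun 'I_d -> 'I_N.*2.+1}].
have us : uniq s by rewrite map_inj_uniq ?enum_uniq//; exact: kernel_freq_inj.
exists [set` s]; first by split => //; exact: finite_seq.
by rewrite -fsbig_seq// big_map big_enum -sumEFin.
Qed.

(* The smoothed function is a trigonometric polynomial whose coefficients are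
   those of [f] damped by [kernel_coef g / kernel_mass N], which is at most 1,
   and equal to 1 at frequency 0. *)
Lemma quadrature_smoothing (T : finType) (c : T -> R) (x : T -> 'rV[R]_d)
    (r : 'rV[int]_d -> R) (B : R) f N :
  (forall k, 0 <= r k) -> 0 <= B -> \sum_t c t = 1 ->
  (forall k, k != 0 ->
    Normc.normc (\sum_t (c t)%:C * unit_char (dotp k (x t))) <= B * r k) ->
  cube_integrable f -> (weighted_norm r f <= 1)%E ->
  `|\sum_t c t * (smoothing f N (x t) / kernel_mass N) - cube_integral f| <= B.
Proof.
move=> r0 B0 c1 hS fi fn.
have A0 := kernel_mass_gt0 N.
pose S k := \sum_t (c t)%:C * unit_char (dotp k (x t)).
have E : \sum_t c t * smoothing f N (x t) =
    \sum_g kernel_coef g *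
      complex.Re (fourier_coef f (kernel_freq (N := N) g) * S (kernel_freq g)).
  under eq_bigr do rewrite smoothingE// mulr_sumr.
  rewrite exchange_big; apply: eq_bigr => g _ /=.
  rewrite /S mulr_sumr Re_sum mulr_sumr.
  apply: eq_bigr => t _; rewrite mulrCA; congr (_ * _).
  by rewrite mulrCA Re_scale.
under eq_bigr do rewrite mulrA.
rewrite -mulr_suml E -(ler_pM2r A0) -(gtr0_norm A0) -normrM (gtr0_norm A0).
rewrite mulrBl divfK ?gt_eqF//.
have S0 : S 0 = 1.
  rewrite /S (eq_bigr (fun t => (c t)%:C)) => [|t _].
    by rewrite -rmorph_sum c1.
  by rewrite /dotp big1 ?unit_char0 ?mulr1// => i _; rewrite mxE mul0r.
(* Since the weights sum to 1, the term at frequency 0 is exactly [kernel_mass N] times the integral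
   of [f], and cancels. *)
rewrite (bigD1 (kernel_freq_center N))//= kernel_freq0 kernel_coef0 S0 mulr1 fourier_coef0.
rewrite [cube_integral f * _]mulrC addrAC subrr add0r.
apply: le_trans (ler_norm_sum _ _ _) _.
apply: (@le_trans _ _ (\sum_(g | g != kernel_freq_center N) kernel_mass N * B *
    (Normc.normc (fourier_coef f (kernel_freq g)) * r (kernel_freq g)))).
  apply: ler_sum => g g0.
  rewrite normrM ger0_norm ?kernel_coef_ge0// -mulrA.
  rewrite ler_pM ?kernel_coef_ge0 ?kernel_coef_le//.
  apply: (@le_trans _ _ (Normc.normc (fourier_coef f (kernel_freq g) * S (kernel_freq g)))).
    exact: normr_Re_le.
  rewrite Normc.normcM mulrCA; apply: ler_wpM2l; first exact: normc_ge0.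
  by apply: hS; rewrite -(kernel_freq0 N) (inj_eq (@kernel_freq_inj N)).
rewrite -mulr_sumr [B * _]mulrC; apply: ler_piMr; first by rewrite mulr_ge0// ltW.
apply: le_trans (weighted_norm_sum_le N r0 fn).
rewrite [leRHS](bigD1 (kernel_freq_center N))//= lerDr mulr_ge0// normc_ge0.
Qed.

End kernel.

(** * Recovery of the values at interior points *)

Section convergence.
Local Open Scope classical_set_scope.
Context {R : realType}.

Lemma ge1Dmuln (u : R) n : 0 <= u -> 1 + n%:R * u <= (1 + u) ^+ n.
Proof.
move=> u0; elim: n => [|n IH]; first by rewrite mul0r addr0 expr0.
rewrite exprSr -natr1; apply: (@le_trans _ _ ((1 + n%:R * u) * (1 + u))).
  have : 0 <= n%:R * (u * u) by rewrite !mulr_ge0.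
  by nra.
by rewrite ler_wpM2r// addr_ge0.
Qed.

Lemma ge1Bmuln (u : R) n : 0 <= u <= 1 -> 1 - n%:R * u <= (1 - u) ^+ n.
Proof.
move=> /andP[u0 u1]; elim: n => [|n IH]; first by rewrite mul0r subr0 expr0.
rewrite exprSr -natr1; apply: (@le_trans _ _ ((1 - n%:R * u) * (1 - u))).
  have : 0 <= n%:R * (u * u) by rewrite !mulr_ge0.
  by nra.
by rewrite ler_wpM2r// subr_ge0.
Qed.

(** With [q <= s ^ d.+1] for some [s < 1], each of [d] factors [s ^ N] absorbs one factor [2 N + 1]
    up to a constant [K], and the last one still tends to 0. *)
Lemma cvg_geometric_poly (q : R) (d : nat) : 0 <= q < 1 ->
  (fun N : nat => q ^+ N * N.*2.+1%:R ^+ d) @ \oo --> (0 : R).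
Proof.
move=> /andP[q0 q1].
(* Bernoulli gives [s ^ d.+1 >= 1 - (d + 1) u >= q]; the denominator [d + 2] keeps [s] positive even
   for [d = 0] and [q = 0]. *)
pose u := (1 - q) / d.+2%:R; pose s := 1 - u.
have d2 : 0 < d.+2%:R :> R by [].
have u0 : 0 < u by rewrite divr_gt0// subr_gt0.
have ud : u * d.+2%:R = 1 - q by rewrite divfK// gt_eqF.
have dd : d.+2%:R = d%:R + 2 :> R by rewrite -addn2 natrD.
have d0 : 0 <= d%:R :> R by [].
have s0 : 0 < s by rewrite /s; nra.
have s1 : s < 1 by rewrite /s; lra.
have qs : q <= s ^+ d.+1.
  apply: le_trans (ge1Bmuln _ _); last by apply/andP; split; rewrite /s in s0; lra.
  by rewrite -natr1; nra.
pose v := s^-1 - 1.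
have v0 : 0 < v by rewrite subr_gt0 invf_gt1.
(* Chosen so that [K (1 + N v) >= 2 N + 1]. *)
pose K := 2 / v + 1.
have K0 : 0 <= K by rewrite addr_ge0// divr_ge0// ltW.
have sN N : N.*2.+1%:R * s ^+ N <= K.
  rewrite -ler_pdivlMr ?exprn_gt0// -exprVn.
  have -> : s^-1 = 1 + v by rewrite /v; ring.
  apply: le_trans (_ : K * (1 + N%:R * v) <= _); last by rewrite ler_wpM2l// ge1Dmuln// ltW.
  have -> : K * (1 + N%:R * v) = 2 / v + 1 + 2 * N%:R + N%:R * v.
    by rewrite /K; field; rewrite gt_eqF.
  have h1 : 0 <= 2 / v by rewrite divr_ge0// ltW.
  have h2 : 0 <= N%:R * v by rewrite mulr_ge0// ltW.
  by rewrite -natr1 -mul2n natrM; lra.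
apply: (@squeeze_cvgr _ _ _ _ (fun=> 0) (fun N => K ^+ d * s ^+ N)).
- near=> N; rewrite mulr_ge0 ?exprn_ge0//=.
  apply: (@le_trans _ _ ((s ^+ d.+1) ^+ N * N.*2.+1%:R ^+ d)).
    by rewrite ler_wpM2r ?exprn_ge0// lerXn2r ?nnegrE ?exprn_ge0// ltW.
  rewrite exprSr exprMn mulrAC ler_wpM2r ?exprn_ge0//; first exact: ltW.
  rewrite exprAC -exprMn lerXn2r ?nnegrE// ?mulr_ge0 ?exprn_ge0//; first exact: ltW.
  by rewrite mulrC.
- exact: cvg_cst.
- by apply: cvg_geometric; rewrite ger0_norm// ltW.
Unshelve. all: by end_near. Qed.

(** [cos (2 pi t)] decreases on [[0, 1/2]] and is symmetric about [1/2]. *)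
Lemma cos_le_off (delta y : R) : 0 < delta -> delta <= 2^-1 -> delta <= `|y| <= 1 - delta ->
  cos (2 * pi * y) <= cos (2 * pi * delta).
Proof.
move=> d0 d2 /andP[dy yd].
have pi0 := pi_gt0 R.
have mono (a b : R) : 0 <= a -> a <= b -> b <= 2^-1 -> cos (2 * pi * b) <= cos (2 * pi * a).
  move=> a0 ab b2; rewrite leNgt; apply/negP; rewrite ltr_cos ?in_itv/=; first by nra.
    by apply/andP; split; nra.
  by apply/andP; split; nra.
rewrite -(cos_norm (2 * pi * y)) normrM (@gtr0_norm _ (2 * pi)) ?mulr_gt0//.
have [y2|y2] := leP `|y| 2^-1; first by apply: mono => //; exact: ltW.
have -> : 2 * pi * `|y| = - (2 * pi * (1 - `|y|)) + pi *+ 2 by ring.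
by rewrite cosD2pi cosN; apply: mono; lra.
Qed.

Lemma peak_le1 N (y : R) : peak N y <= 1.
Proof.
have := cos_le1 (2 * pi * y); have := cos_geN1 (2 * pi * y) => h1 h2.
by rewrite exprn_ile1// ?divr_ge0// ?ler_pdivrMr//; lra.
Qed.

Context (d : nat).
Implicit Types (f : 'rV[R]_d -> R) (x : 'rV[R]_d).

Lemma kernel_ge0 N x : 0 <= cube_kernel N x.
Proof. by rewrite prodr_ge0// => j _; exact: peak_ge0. Qed.

Lemma kernel_le N x j (q : R) :
  (1 + cos (2 * pi * x 0 j)) / 2 <= q -> cube_kernel N x <= q ^+ N.
Proof.
move=> cq; have c0 : 0 <= (1 + cos (2 * pi * x 0 j)) / 2.
  by have := cos_geN1 (2 * pi * x 0 j); lra.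
rewrite /cube_kernel (bigD1 j)//=.
apply: (@le_trans _ _ (peak N (x 0 j) * 1)).
  rewrite ler_wpM2l ?peak_ge0//; apply: prodr_ile1 => i _; by rewrite peak_ge0 peak_le1.
by rewrite mulr1 lerXn2r// nnegrE (le_trans c0).
Qed.

Lemma kernel_le1 N x : cube_kernel N x <= 1.
Proof. by apply: prodr_ile1 => i _; rewrite peak_ge0 peak_le1. Qed.

Lemma cube_measurable_kernel N x0 : cube_measurable (fun x => cube_kernel N (x0 - x)).
Proof.
have := @measurable_prod_tnth R d (fun i y => peak N (x0 0 i - y))
  (fun i => measurable_peak N (x0 0 i)).
apply: eq_measurable_fun => t _; rewrite /cube_kernel /=.
by apply: eq_bigr => i _; rewrite !mxE.
Qed.

Lemma cube_integrable_kernel N x0 : cube_integrable (fun x => cube_kernel N (x0 - x)).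
Proof.
apply: (@cube_integrable_bounded _ _ _ 1) => [|x]; first exact: cube_measurable_kernel.
by rewrite ger0_norm ?kernel_ge0// kernel_le1.
Qed.

Lemma cube_integral_kernel N x0 :
  cube_integral (fun x => cube_kernel N (x0 - x)) = kernel_mass (R := R) d N.
Proof.
have := @integral_cube_prod R d (fun i y => peak N (x0 0 i - y)) (fun=> peak_coef N N)
  (fun i => measurable_peak N (x0 0 i)) (fun i y => peak_ge0 N _) (fun i => integral_peak N _).
rewrite /kernel_mass prodr_const card_ord => /(congr1 fine) /= <-; congr fine.
apply: eq_integral => t _.
by congr EFin; apply: eq_bigr => i _; rewrite !mxE.
Qed.

Lemma within_cube_ball f x0 (eta : R) : {within @unit_cube R d, continuous f} ->
  unit_cube x0 -> 0 < eta ->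
  exists2 delta, 0 < delta & forall x, unit_cube x ->
    (forall j, `|x0 0 j - x 0 j| < delta) -> `|f x0 - f x| < eta.
Proof.
move=> cf x0D eta0; have /cvgrPdist_lt /(_ _ eta0) := cf x0.
rewrite /prop_near1 /nbhs /= -nbhs_subspace_in// => /nbhs_ballP[delta /= delta0 H].
exists delta => // x xD xx; apply: H => //; split => // i j; rewrite ord1; exact: xx.
Qed.

Lemma kernel_mass_ge N : N.*2.+1%:R ^- d <= kernel_mass (R := R) d N.
Proof.
rewrite /kernel_mass -exprVn lerXn2r ?nnegrE ?invr_ge0 ?divr_ge0 ?exprn_ge0//.
rewrite /peak_coef ler_pdivlMr ?exprn_gt0// ler_pdivrMl ?ltr0n// -natrX -natrM ler_nat.
exact: expn4_leq_central.
Qed.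

(** Near [x0] continuity bounds the error by [eta / 2]. Elsewhere the kernel is at most [q ^ N],
    which is integrated against [|f| + |f x0|]: this asks for integrability of [f], not boundedness.
    Division by the mass costs only a factor [(2 N + 1) ^ d]. *)
Lemma smoothing_cvg f x0 : cube_integrable f -> {within @unit_cube R d, continuous f} ->
  (forall j, 0 < x0 0 j < 1) ->
  (fun N : nat => smoothing f N x0 / kernel_mass (R := R) d N) @ \oo --> f x0.
Proof.
move=> fi cf x01.
have x0D : unit_cube x0 by move=> j; have /andP[/ltW -> ->] := x01 j.
apply/cvgrPdist_le => eta eta0.
have eta2 : 0 < eta / 2 by rewrite divr_gt0.
have [delta1 delta10 Hf] := within_cube_ball cf x0D eta2.
(* At most the distance from [x0] to each face: for [x] in the cube, [x0 - x] then has coordinates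
   of absolute value at most [1 - delta], away from the peaks of the kernel at 1 and -1. *)
pose delta :=
  Num.min delta1 (Num.min 2^-1 (\big[Num.min/1]_j Num.min (x0 0 j) (1 - x0 0 j))).
have delta0 : 0 < delta.
  rewrite !lt_min delta10 invr_gt0 ltr0n /=; apply: lt_bigmin => // j _.
  by rewrite lt_min subr_gt0; exact: x01.
have dd1 : delta <= delta1 by rewrite ge_min lexx.
have dd2 : delta <= 2^-1 by rewrite !ge_min lexx orbT.
have dj j : delta <= x0 0 j <= 1 - delta.
  have : delta <= Num.min (x0 0 j) (1 - x0 0 j).
    rewrite ge_min ge_min; apply/orP; right; apply/orP; right; exact: bigmin_le.
  by rewrite le_min; lra.
pose q := (1 + cos (2 * pi * delta)) / 2.
have pi0 := pi_gt0 R.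
have q01 : 0 <= q < 1.
  have : cos (2 * pi * delta) < cos 0 by rewrite ltr_cos ?in_itv/=; nra.
  by rewrite cos0 /q; have := cos_geN1 (2 * pi * delta); lra.
pose G x := `|f x| + `|f x0|.
have iG : cube_integrable G.
  apply: cube_integrableD; first exact: cube_integrable_norm.
  apply: (@cube_integrable_bounded _ _ _ `|f x0|) => [|x]; last by rewrite normr_id.
  exact: measurable_cst.
pose J := cube_integral G.
have J0 : 0 <= J by apply: Rintegral_ge0 => t _; rewrite addr_ge0.
have pt N x : unit_cube x ->
    `|(f x0 - f x) * cube_kernel N (x0 - x)| <=
    eta / 2 * cube_kernel N (x0 - x) + q ^+ N * G x.
  move=> xD; rewrite normrM (ger0_norm (kernel_ge0 _ _)).
  have Gx0 : 0 <= G x by rewrite addr_ge0.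
  have qN : 0 <= q ^+ N by rewrite exprn_ge0//; case/andP: q01.
  have K0 := kernel_ge0 N (x0 - x).
  have [[j xj]|near] := pselect (exists j, delta <= `|x0 0 j - x 0 j|).
    apply: (@le_trans _ _ (G x * q ^+ N)); last first.
      by rewrite mulrC lerDr mulr_ge0// ltW.
    apply: ler_pM => //; first by apply: le_trans (ler_normB _ _) _; rewrite /G addrC.
    apply: (@kernel_le _ _ j); rewrite /q ler_pM2r ?invr_gt0// lerD2l !mxE.
    apply: cos_le_off => //; rewrite xj/=.
    have := dj j; have := xD j; rewrite ler_norml; lra.
  rewrite -[leLHS]addr0 lerD ?mulr_ge0// ler_wpM2r// ltW//.
  apply: Hf => // j; rewrite ltNge; apply/negP => h; apply: near; exists j.
  exact: le_trans h.
have est N : `|f x0 - smoothing f N x0 / kernel_mass (R := R) d N| <=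
    eta / 2 + J * (q ^+ N * N.*2.+1%:R ^+ d).
  have A0 := kernel_mass_gt0 (R := R) d N.
  have iK := cube_integrable_kernel N x0.
  have iKf : cube_integrable (fun x => f x * cube_kernel N (x0 - x)).
    apply: (cube_integrableMl (M := 1) fi); first exact: cube_measurable_kernel.
    by move=> x; rewrite ger0_norm ?kernel_ge0// kernel_le1.
  have E : f x0 * kernel_mass d N - smoothing f N x0 =
      cube_integral (fun x => (f x0 - f x) * cube_kernel N (x0 - x)).
    rewrite -(cube_integral_kernel N x0) -cube_integralZl// /smoothing.
    rewrite -[X in _ - X]mul1r -mulNr -cube_integralZl// -cube_integralD//;
      try exact: cube_integrableZl.
    by apply: eq_cube_integral => x; ring.
  have iH : cube_integrable (fun x => (f x0 - f x) * cube_kernel N (x0 - x)).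
    have := cube_integrableD (cube_integrableZl (f x0) iK) (cube_integrableZl (-1) iKf).
    by apply: eq_integrable => [|t _]; [exact: measurable_cube|rewrite /=; congr EFin; ring].
  rewrite -(ler_pM2r A0) -[X in _ * X <= _](gtr0_norm A0) -normrM mulrBl divfK ?gt_eqF// E.
  apply: (le_trans (normr_cube_integral iH)).
  apply: (@le_trans _ _
    (cube_integral (fun x => eta / 2 * cube_kernel N (x0 - x) + q ^+ N * G x))).
    apply: le_cube_integral; first exact: cube_integrable_norm.
      by apply: cube_integrableD; exact: cube_integrableZl.
    exact: pt.
  have -> : cube_integral (fun x => eta / 2 * cube_kernel N (x0 - x) + q ^+ N * G x) =
      eta / 2 * kernel_mass d N + q ^+ N * J.
    rewrite -(cube_integral_kernel N x0) -!cube_integralZl// -cube_integralD//;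
      exact: cube_integrableZl.
  rewrite mulrDl lerD2l mulrC -!mulrA ler_wpM2l//.
  rewrite ler_peMr ?exprn_ge0//; first by case/andP: q01.
  rewrite mulrC -ler_pdivrMr ?exprn_gt0// div1r; exact: kernel_mass_ge.
have Jq : (fun N : nat => J * (q ^+ N * N.*2.+1%:R ^+ d)) @ \oo --> (0 : R).
  by rewrite -[X in _ --> X](mulr0 J); apply: cvgMr; exact: cvg_geometric_poly.
move/cvgrPdist_le : Jq => /(_ _ eta2); apply: filterS => N.
by rewrite sub0r normrN => /(le_trans (ler_norm _)) HN; apply: (le_trans (est N)); lra.
Qed.

End convergence.

(** * The quadrature rule *)

Section quadrature.
Local Open Scope classical_set_scope.
Context {R : realType} (d : nat).
Local Open Scope complex_scope.

Lemma normc_real (a : R) : Normc.normc a%:C = `|a|.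
Proof. by rewrite /Normc.normc/= (expr0n _ 2)/= addr0 sqrtr_sqr. Qed.

(** The bound of [quadrature_smoothing] is uniform in [N], so it passes to the limit at the finitely
    many interior nodes. *)
Lemma quadrature_error_le (T : finType) (c : T -> R) (x : T -> 'rV[R]_d)
    (r : 'rV[int]_d -> R) (B : R) (f : 'rV[R]_d -> R) :
  (forall k, 0 <= r k) -> 0 <= B -> \sum_t c t = 1 ->
  (forall t j, 0 < x t 0 j < 1) ->
  (forall k, k != 0 ->
    Normc.normc (\sum_t (c t)%:C * unit_char (dotp k (x t))) <= B * r k) ->
  wiener_space r f -> (weighted_norm r f <= 1)%E ->
  `|\sum_t c t * f (x t) - cube_integral f| <= B.
Proof.
move=> r0 B0 c1 x01 hS [cf fi _] fn.
have L : (fun N : nat =>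
      `|\sum_t c t * (smoothing f N (x t) / kernel_mass d N) - cube_integral f|)
    @ \oo --> `|\sum_t c t * f (x t) - cube_integral f|.
  apply: cvg_norm; apply: cvgB; last exact: cvg_cst.
  apply: cvg_big => [|t _]; first exact: add_continuous.
  by apply: cvgMr; exact: smoothing_cvg.
apply: (cvgr_to_le L); apply: nearW => N; exact: (quadrature_smoothing (r := r)).
Qed.

Lemma n_wor_le (T : finType) (c : T -> R) (x : T -> 'rV[R]_d)
    (r : 'rV[int]_d -> R) (eps : R) :
  (forall k, 0 <= r k) -> 0 <= eps -> \sum_t c t = 1 ->
  (forall t j, 0 < x t 0 j < 1) ->
  (forall k, k != 0 ->
    Normc.normc (\sum_t (c t)%:C * unit_char (dotp k (x t))) <= eps * r k) ->
  (n_wor eps r <= #|T|%:R%:E)%E.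
Proof.
move=> r0 e0 c1 x01 hS; apply: ereal_inf_lbound; exists #|T| => //.
exists (fun h => c (enum_val h)), (fun h => x (enum_val h)); split.
  by move=> h j; have /andP[/ltW -> ->] := x01 (enum_val h) j.
apply: ge_ereal_sup => _ [f [fr fn] <-]; rewrite lee_fin distrC /linear_algorithm.
rewrite -(big_enum_val (A := T) (fun t => c t * f (x t))).
exact: (quadrature_error_le (r := r)).
Qed.

End quadrature.

(** * Averaging over several primes *)

Section korobov_rule.
Local Open Scope classical_set_scope.
Context {R : realType} (d : nat).
Local Open Scope complex_scope.
Context (s : seq nat) (N M m : nat).
Context (N0 : (0 < N)%N) (sN : size s = N).
Context (s_prime : forall p, p \in s -> prime p).
Context (s_itv : forall p, p \in s -> (m <= p <= M)%N).

(* For the [i]-th prime [p] of [s] the nodes are indexed by [h, l < p]. All primes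
   share the index type ['I_M * 'I_M]; superfluous indices get weight 0. *)
Definition rule_weight (t : 'I_N * 'I_M * 'I_M) : R :=
  let p := nth 0%N s t.1.1 in
  if (t.1.2 < p)%N && (t.2 < p)%N then N%:R^-1 * p%:R ^- 2 else 0.

Definition rule_point (t : 'I_N * 'I_M * 'I_M) : 'rV[R]_d :=
  korobov_point d (nth 0%N s t.1.1) t.1.2 t.2.

Let nth_in (i : 'I_N) : nth 0%N s i \in s.
Proof. by rewrite mem_nth// sN. Qed.

Let nth_gt0 (i : 'I_N) : (0 < nth 0%N s i)%N.
Proof. exact/prime_gt0/s_prime/nth_in. Qed.

Lemma rule_point_itv t j : 0 < rule_point t 0 j < 1.
Proof. exact: korobov_point_itv. Qed.

Lemma rule_sum (F : nat -> nat -> nat -> R[i]) :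
  \sum_t (rule_weight t)%:C * F (nth 0%N s t.1.1) t.1.2 t.2 =
  \sum_(i < N) (N%:R^-1 * (nth 0%N s i)%:R ^- 2)%:C *
    \sum_(h < nth 0%N s i) \sum_(l < nth 0%N s i) F (nth 0%N s i) h l.
Proof.
rewrite -(pair_bigA _ (fun ih l => (rule_weight (ih, l))%:C * F (nth 0%N s ih.1) ih.2 l))/=.
rewrite -(pair_bigA _ (fun i h =>
  \sum_l (rule_weight (i, h, l))%:C * F (nth 0%N s i) h l))/=.
apply: eq_bigr => i _; set p := nth 0%N s i.
have pM : (p <= M)%N by have /andP[] := s_itv (nth_in i).
rewrite (big_ord_widen _ (fun h => \sum_(l < p) F p h l) pM) mulr_sumr [RHS]big_mkcond/=.
apply: eq_bigr => h _; case: ifPn => [hp|hp]; last first.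
  by rewrite big1// => l _; rewrite /rule_weight/= (negbTE hp) mul0r.
rewrite (big_ord_widen _ (fun l => F p h l) pM) mulr_sumr [RHS]big_mkcond/=.
apply: eq_bigr => l _; rewrite /rule_weight/= -/p hp /=.
by case: ifP => // _; rewrite mul0r.
Qed.

Lemma sum_rule_weight : \sum_t rule_weight t = 1.
Proof.
apply: (@complexI R); rewrite rmorph_sum/=.
transitivity (\sum_t (rule_weight t)%:C * 1); first by apply: eq_bigr => t _; rewrite mulr1.
rewrite (rule_sum (fun _ _ _ => 1)).
rewrite (eq_bigr (fun=> (N%:R^-1)%:C)) => [|i _].
  by rewrite sumr_const card_ord -rmorphMn/= -mulr_natr mulVf// pnatr_eq0; lia.
under eq_bigr do rewrite sumr_const card_ord.
rewrite sumr_const card_ord -mulrnA -(rmorph_nat (real_complex R)) -rmorphM/=; congr (_%:C).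
rewrite natrM -mulrA -[RHS]mulr1; congr (_ * _); rewrite -expr2 mulVf//.
by rewrite expf_neq0// pnatr_eq0; have := nth_gt0 i; lia.
Qed.

(** Each prime contributes its width term, plus 1 if it divides [min_freq k]; averaging turns the
    latter into the proportion of such primes. *)
Lemma sum_rule_unit_char_le (k : 'rV[int]_d) : (0 < m)%N -> k != 0 ->
  Normc.normc (\sum_t (rule_weight t)%:C * unit_char (dotp k (rule_point t))) <=
  (width (supp k))%:R / m%:R + (count (dvdn^~ (min_freq k)) s)%:R / N%:R.
Proof.
move=> m0 k0.
rewrite (rule_sum (fun p h l => unit_char (dotp k (korobov_point d p h l)))).
apply: le_trans (normc_sum _ _ _) _.
apply: (@le_trans _ _ (\sum_(i < N) N%:R^-1 *
   ((width (supp k))%:R / m%:R + (nth 0%N s i %| min_freq k)%N%:R))).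
  apply: ler_sum => i _; set p := nth 0%N s i; rewrite Normc.normcM.
  have p0 : 0 < p%:R :> R by rewrite ltr0n nth_gt0.
  have N0R : 0 < N%:R :> R by rewrite ltr0n.
  have -> : Normc.normc (N%:R^-1 * p%:R ^- 2 : R)%:C = N%:R^-1 * p%:R ^- 2.
    rewrite normc_real ger0_norm// mulr_ge0 ?invr_ge0 ?exprn_ge0// ltW//.
  rewrite -mulrA; apply: ler_wpM2l; first by rewrite invr_ge0 ltW.
  apply: le_trans (ler_wpM2l _ (normc_korobov_sum (s_prime (nth_in i)) k0)) _.
    by rewrite invr_ge0 exprn_ge0// ltW.
  rewrite -/p natrD natrM.
  have -> : p%:R ^- 2 * (p%:R * ((width (supp k))%:R + p%:R * (p %| min_freq k)%N%:R)) =
     (width (supp k))%:R / p%:R + (p %| min_freq k)%N%:R :> R by field; rewrite gt_eqF.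
  have m0R : 0 < m%:R :> R by rewrite ltr0n.
  rewrite lerD2r ler_wpM2l// lef_pV2// ler_nat.
  by have /andP[] := s_itv (nth_in i).
rewrite -mulr_sumr big_split/= sumr_const card_ord mulrDr -[_ / _ *+ N]mulr_natl.
rewrite mulKf; last by rewrite pnatr_eq0; lia.
rewrite lerD2l mulrC ler_pM2r ?invr_gt0 ?ltr0n// -natr_sum ler_nat.
rewrite -sum1_count (big_nth 0%N) sN big_mkord [leqRHS]big_mkcond/=.
by apply: leq_sum => i _; case: ifP.
Qed.

(** The product of the distinct primes of [s] dividing [n] divides [n], and each is at least [m]. So
    few primes are bad for a given frequency. *)
Lemma expn_count_dvd n : uniq s -> (0 < n)%N -> (m ^ count (dvdn^~ n) s <= n)%N.
Proof.
move=> s_uniq n0; rewrite -size_filter.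
apply: (@leq_trans (\prod_(p <- s | (p %| n)%N) p)%N).
  rewrite -big_filter; apply: leq_pow_prod => p; rewrite mem_filter => /andP[_ /s_itv /andP[]//].
apply: dvdn_leq => //; rewrite -big_filter; apply: prod_primes_dvd.
- exact: filter_uniq.
- by apply/allP => p; rewrite mem_filter => /andP[_ /s_prime].
- by apply/allP => p; rewrite mem_filter => /andP[].
Qed.

End korobov_rule.

(** * The error in terms of the weight *)

Section weight_r2.
Context {R : realType} (d : nat).
Implicit Types k : 'rV[int]_d.

Lemma min_freq_gt0 k : k != 0 -> (0 < min_freq k)%N.
Proof.
move=> /supp_neq0 /(@minimum_over_attained _ (supp k) (fun j => `|k 0%R j|%N)) [j].
by rewrite /min_freq inE => kj ->; rewrite absz_gt0.
Qed.

Lemma width_le_r2 k : k != 0 -> (width (supp k))%:R <= r2 k :> R.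
Proof. by move=> /negbTE k0; rewrite /r2 k0 le_max lexx. Qed.

Lemma ln_min_freq_le_r2 k : k != 0 -> ln (min_freq k)%:R <= r2 k :> R.
Proof. by move=> /negbTE k0; rewrite /r2 k0 le_max lexx orbT. Qed.

Lemma ln4_ge : 3 / 4 <= ln 4 :> R.
Proof.
have := @le_ln1Dx R (- (3 / 4)); rewrite (_ : 1 + - (3 / 4) = 4^-1); last by field.
by rewrite lnV ?posrE// => /(_ _); lra.
Qed.

Lemma ln4_le : ln 4 <= 3 :> R.
Proof. by have := @le_ln1Dx R 3; rewrite (_ : 1 + 3 = 4); [apply; lra|ring]. Qed.

(** With [m = 4 ^ n] the tolerance is [16 / m]. One unit of [r2 k / m] pays for the width, the other
    15 for the bad primes: there are [O(r2 k / n)] of them among [N], which is of order [m / n]. *)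
Lemma n_wor_r2_le (n : nat) (eps : R) : (6 <= n)%N -> 64 / (4 ^ n.+1)%N%:R <= eps ->
  (n_wor eps (@r2 R d) <= ((4 ^ n %/ (2 * n.+1)) * 4 ^ n.+1 * 4 ^ n.+1)%N%:R%:E)%E.
Proof.
move=> n6 epsE; set N := (_ %/ _)%N; set M := (4 ^ n.+1)%N; set m := (4 ^ n)%N.
have ME : M = (4 * m)%N by rewrite /M expnS.
have m0 : (0 < m)%N by rewrite expn_gt0.
have mN : (m < N.+1 * (2 * n.+1))%N by exact: ltn_ceil.
have N0 : (0 < N)%N by rewrite divn_gt0//; have := small_correction n6; rewrite -/m; nia.
(* The window may hold more primes; keeping exactly [N] fixes the number of nodes. *)
pose s := take N [seq p <- index_iota (4 ^ n).+1 (4 ^ n.+1).+1 | prime p].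
have sN : size s = N by rewrite size_takel// many_primes.
have us : uniq s by rewrite take_uniq// filter_uniq// iota_uniq.
have s_in p : p \in s -> prime p && (m < p <= M)%N.
  by move=> /mem_take; rewrite mem_filter mem_index_iota ltnS.
have s_prime p : p \in s -> prime p by move=> /s_in /andP[].
have s_itv p : p \in s -> (m <= p <= M)%N by move=> /s_in /and3P[_ /ltnW -> ->].
have e0 : 0 <= eps by apply: le_trans epsE.
have := @n_wor_le R d ('I_N * 'I_M * 'I_M)%type
  (@rule_weight R s N M) (@rule_point R d s N M) (@r2 R d) eps.
rewrite !card_prod !card_ord; apply => //.
- by move=> k; apply: le_trans (r2_ge1 k).
- exact: (sum_rule_weight N0 sN s_prime s_itv).
- by move=> t j; exact: (rule_point_itv sN s_prime).
move=> k k0; apply: le_trans (sum_rule_unit_char_le N0 sN s_prime s_itv m0 k0) _.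
have r0 : 0 <= r2 k :> R by apply: le_trans (r2_ge1 k).
apply: le_trans (ler_wpM2r r0 epsE).
set w := (width _)%:R; set cnt := count _ _.
have wr : w <= r2 k :> R by exact: width_le_r2.
have lr := @ln_min_freq_le_r2 k k0.
have mR : 0 < m%:R :> R by rewrite ltr0n.
have NR : 0 < N%:R :> R by rewrite ltr0n.
have nR : 6 <= n%:R :> R by rewrite (ler_nat _ 6).
have cntE : cnt%:R * (n%:R * (3 / 4)) <= r2 k :> R.
  apply: le_trans lr; have := expn_count_dvd s_prime s_itv us (min_freq_gt0 k0).
  rewrite -/cnt /m -expnM => h.
  apply: (@le_trans _ _ (ln (4 ^ (n * cnt))%N%:R)).
    rewrite natrX lnXn// -[ln 4 *+ _]mulr_natl natrM.
    rewrite mulrA [cnt%:R * _]mulrC ler_wpM2l ?mulr_ge0//; exact: ln4_ge.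
  by rewrite ler_ln ?posrE ?ltr0n ?expn_gt0 ?min_freq_gt0// ler_nat.
(* The floor defining [N] loses at most a factor 2, because [N >= 1]. *)
have mNR : m%:R <= N%:R * (4 * (n%:R + 1)) :> R.
  by rewrite natr1 -!natrM ler_nat; nia.
rewrite -/M ME natrM.
have c0 : 0 <= cnt%:R :> R by [].
have h1 : cnt%:R * (n%:R + 1) <= 3 * r2 k :> R by nra.
have h2 : m%:R * cnt%:R <= 15 * r2 k * N%:R :> R.
  apply: le_trans (ler_wpM2r c0 mNR) _.
  rewrite [leLHS](_ : _ = N%:R * (4 * (cnt%:R * (n%:R + 1)))); last by ring.
  rewrite [leRHS]mulrC; apply: ler_wpM2l; first exact: ltW.
  by lra.
have -> : 64 / (4 * m%:R) * r2 k = (r2 k + 15 * r2 k) / m%:R :> R by field; rewrite gt_eqF.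
rewrite mulrDl lerD// ?ler_pM2r ?invr_gt0//.
by rewrite ler_pdivrMr// mulrAC ler_pdivlMr// mulrC.
Qed.

End weight_r2.

Theorem theorem2 (R : realType) :
  exists C : R, 0 < C /\
    forall (d : nat) (eps : R), (0 < d)%N -> 0 < eps < 1 ->
      (n_wor eps (@r2 R d) <= (C * eps ^- 3 / ln (eps^-1))%:E)%E.
Proof.
(* The cube of [4 ^ 8], since [M] below stays under [4 ^ 8 / eps]. *)
exists (4 ^+ 24); split; first by rewrite exprn_gt0.
move=> d eps _ /andP[e0 e1].
(* [M] will be the least power of 4 that is at least [A], so [M < 4 A]. The factor [4 ^ 7] makes its
   exponent large enough for [n_wor_r2_le] and exceeds the 64 required there. *)
pose A : R := 4 ^+ 7 / eps.
have A0 : 0 < A by rewrite divr_gt0// exprn_gt0.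
have ex : exists i, A <= (4 ^ i)%N%:R.
  exists (Num.bound A); apply: le_trans (ltW (archi_boundP (ltW A0))) _.
  by rewrite ler_nat ltnW// ltn_expl.
case: (ex_minnP ex) => i iP imin.
have i7 : (7 < i)%N.
  rewrite ltnNge; apply/negP => i7; move: iP; rewrite leNgt => /negP; apply.
  rewrite natrX ltr_pdivlMr//; apply: (@lt_le_trans _ _ (4 ^+ i)).
    by rewrite -[ltRHS]mulr1 ltr_pM2l ?exprn_gt0.
  by rewrite ler_weXn2l// ler1n.
case: i => // n in iP imin i7 *.
have AM : (4 ^ n)%N%:R < A.
  by rewrite ltNge; apply/negP => /imin; rewrite ltnn.
set M : R := (4 ^ n.+1)%N%:R in iP.
have M0 : 0 < M by rewrite ltr0n expn_gt0.
have Meps : 64 / M <= eps.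
  rewrite ler_pdivrMr// mulrC -ler_pdivrMr//; apply: le_trans iP.
  by rewrite /A ler_pM2r ?invr_gt0//; lra.
apply: le_trans (n_wor_r2_le d (ltnW i7) Meps) _.
rewrite lee_fin.
have lneps : 0 < ln eps^-1 by rewrite ln_gt0// invf_gt1.
have lnM3 : ln eps^-1 <= 3 * n.+1%:R.
  apply: (@le_trans _ _ (ln M)).
    rewrite ler_ln ?posrE ?invr_gt0//; apply: le_trans iP.
    rewrite /A -[leLHS]mul1r ler_pM2r ?invr_gt0//; lra.
  rewrite /M natrX lnXn// -[ln 4 *+ _]mulr_natr ler_wpM2r//; exact: ln4_le.
have nbound : (4 ^ n %/ (2 * n.+1))%N%:R * (2 * n.+1%:R) <= M / 4 :> R.
  rewrite (_ : M / 4 = (4 ^ n)%N%:R); last by rewrite /M expnS natrM; field.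
  by rewrite -!natrM ler_nat leq_divM.
have ME : M < 4 ^+ 8 / eps by rewrite /M expnS natrM (exprS 4 7) -mulrA ltr_pM2l.
rewrite !natrM -/M; set q : R := (_ %/ _)%N%:R.
have q0 : 0 <= q by [].
rewrite ler_pdivlMr//.
(* The number [q] of primes is at most [M / (8 (n + 1))] while the logarithm is at most [3 (n + 1)]:
   the density of primes yields the logarithm in the bound. *)
have qln : q * ln eps^-1 <= M.
  by apply: le_trans (ler_wpM2l q0 lnM3) _; rewrite -/q in nbound; lra.
apply: (@le_trans _ _ (M ^+ 3)).
  rewrite (_ : _ * _ * _ * _ = q * ln eps^-1 * (M * M)); last by ring.
  by rewrite exprS expr2 ler_wpM2r// mulr_ge0// ltW.
have -> : 4 ^+ 24 * eps ^- 3 = (4 ^+ 8 / eps) ^+ 3 by rewrite exprMn -exprM exprVn.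
apply: lerXn2r; rewrite ?nnegrE; last exact: ltW.
  exact: ltW.
by rewrite ltW// divr_gt0 ?exprn_gt0.
Qed.
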